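(* Let $\Omega\subset\mathbb{R}^d$ be compact with a probability measure $\mu$, and let $\mathbf{F}$ be a compact subset of $\mathcal{C}(\Omega)$. For $p\in(2,\infty)$ and every constant $B\ge1$ there exist two positive constants $c$ and $C$, which may depend on $p$, such that $$\varrho_m^{lp}(\mathbf{F},L_p)\le C\,d_n^{NpB}(\mathbf{F},L_\infty)$$ provided $m\ge cB^pn(\log(2Bn))^3$ ($m,n$ positive integers).
   Context: $\mathcal{C}(\Omega)$ is the space of continuous functions on $\Omega$; $\|f\|_p:=\left(\int_\Omega|f|^p\,d\mu\right)^{1/p}$ and $\|f\|_\infty:=\max_{\mathbf{x}\in\Omega}|f(\mathbf{x})|$. Recovery algorithm: for points $\xi=\{\xi^j\}_{j=1}^m\subset\Omega$ (repetitions allowed) and a finite-dimensional space $X_N$ of functions, with equal weights $\mathbf{w}_m=(1/m,\dots,1/m)$, let $$\ell p\mathbf{w}_m(\xi,X_N)(f):=\operatorname*{arg\,min}_{u\in X_N}\left(\frac1m\sum_{\nu=1}^m|f(\xi^\nu)-u(\xi^\nu)|^p\right)^{1/p}$$ (a minimizer; any choice if it is not unique). Then $$\varrho_m^{lp}(\mathbf{F},L_p):=\inf_{\xi,\,X_N,\,N\le m}\ \sup_{f\in\mathbf{F}}\|f-\ell p\mathbf{w}_m(\xi,X_N)(f)\|_p,$$ where the infimum is over all $N$-dimensional subspaces $X_N\subset L_p(\Omega,\mu)$ with $N\le m$ and all collections $\xi$ of $m$ points in $\Omega$. Condition NpB: an $N$-dimensional subspace $X_N$ (of continuous functions) satisfies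 Condition NpB, with $B\ge1$, if $|f(\mathbf{x})|\le BN^{1/p}\|f\|_p$ for all $\mathbf{x}\in\Omega$ and $f\in X_N$. The NpB-conditioned Kolmogorov width in the uniform norm is $$d_n^{NpB}(\mathbf{F},L_\infty):=\inf_{X_n}\ \sup_{f\in\mathbf{F}}\ \inf_{g\in X_n}\|f-g\|_\infty,$$ the infimum being over all $n$-dimensional subspaces $X_n$ satisfying Condition NpB (infimum over the empty set is $+\infty$). *)

(* Defs.v *)
From HB Require Import structures.
From mathcomp Require Import all_boot all_order all_algebra.
From mathcomp Require Import all_classical all_reals all_analysis.
Set Implicit Arguments.
Unset Strict Implicit.
Unset Printing Implicit Defensive.
Import Order.TTheory GRing.Theory Num.Theory.
Import numFieldNormedType.Exports.
Local Open Scope classical_set_scope.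
Local Open Scope ring_scope.

(* Functions on Omega are represented by total functions on R^d of which only
   the values on Omega matter; every notion below ignores the other values. *)

Definition borelRd (R : realType) (d : nat) : measurableType _ :=
  g_sigma_algebraType (@open 'rV[R]_d).

Definition lincomb (R : realType) (T : Type) (N : nat)
    (u : 'I_N -> T -> R) (a : 'I_N -> R) : T -> R :=
  fun x => \sum_(i < N) a i * u i x.

(* [Z] is the set of functions identified with 0: those vanishing on Omega for
   subspaces of C(Omega), those vanishing mu-a.e. for subspaces of L_p. *)
Definition subspace_dim (R : realType) (T : Type) (Z : set (T -> R)) (N : nat)
    (X : set (T -> R)) : Prop :=
  exists u : 'I_N -> T -> R,
    X = range (lincomb u) /\
    (forall a, Z (lincomb u a) -> forall i, a i = 0).

Section NormsAndSpaces.
Context (R : realType) (d : nat) (Omega : set 'rV[R]_d).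
Context (mu : probability (borelRd R d) R).

Definition LpN (p : R) (f : 'rV[R]_d -> R) : \bar R :=
  'N[mu]_(p%:E)[EFin \o ((f : borelRd R d -> R) \_ Omega)]%E.

Definition supN (f : 'rV[R]_d -> R) : \bar R :=
  ereal_sup [set (`|f x|)%:E | x in Omega].

Definition in_Lp (p : R) (f : 'rV[R]_d -> R) : Prop :=
  (f : borelRd R d -> R) \_ Omega \in Lfun mu p%:E.

Definition subspace_C (N : nat) (X : set ('rV[R]_d -> R)) : Prop :=
  subspace_dim [set f | forall x, Omega x -> f x = 0] N X /\
  (forall f, X f -> {within Omega, continuous f}).

Definition subspace_Lp (p : R) (N : nat) (X : set ('rV[R]_d -> R)) : Prop :=
  subspace_dim
    [set f | {ae mu, forall x : borelRd R d, Omega x -> f x = 0}] N X /\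
  (forall f, X f -> in_Lp p f).

Definition condNpB (p B : R) (N : nat) (X : set ('rV[R]_d -> R)) : Prop :=
  forall f, X f -> forall x, Omega x ->
    ((`|f x|)%:E <= (B * N%:R `^ p^-1)%:E * LpN p f)%E.

Definition kolmogorov_NpB (p B : R) (n : nat) (F : set ('rV[R]_d -> R)) :
    \bar R :=
  ereal_inf
    [set ereal_sup [set ereal_inf [set supN (f \- g) | g in X] | f in F]
       | X in [set X | subspace_C n X /\ condNpB p B n X]].

Definition discrete_err (p : R) (m : nat) (xi : 'I_m -> 'rV[R]_d)
    (f u : 'rV[R]_d -> R) : R :=
  (m%:R^-1 * \sum_(nu < m) `|f (xi nu) - u (xi nu)| `^ p) `^ p^-1.

Definition lpw_argmin (p : R) (m : nat) (xi : 'I_m -> 'rV[R]_d)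
    (X : set ('rV[R]_d -> R)) (f : 'rV[R]_d -> R) : set ('rV[R]_d -> R) :=
  [set u | X u /\
           forall v, X v -> discrete_err p xi f u <= discrete_err p xi f v].

Definition admissible (p : R) (m : nat) (xi : 'I_m -> 'rV[R]_d)
    (X : set ('rV[R]_d -> R)) : Prop :=
  (forall nu, Omega (xi nu)) /\
  exists N : nat, (0 < N <= m)%N /\ subspace_Lp p N X.

Definition lpw_algorithm (p : R) (m : nat) (F : set ('rV[R]_d -> R))
    (A : ('I_m -> 'rV[R]_d) -> set ('rV[R]_d -> R) ->
         ('rV[R]_d -> R) -> ('rV[R]_d -> R)) : Prop :=
  forall xi X f, admissible p xi X -> F f -> lpw_argmin p xi X f (A xi X f).

Definition varrho_lp (p : R) (m : nat)
    (A : ('I_m -> 'rV[R]_d) -> set ('rV[R]_d -> R) ->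
         ('rV[R]_d -> R) -> ('rV[R]_d -> R))
    (F : set ('rV[R]_d -> R)) : \bar R :=
  ereal_inf
    [set ereal_sup [set LpN p (f \- A xiX.1 xiX.2 f) | f in F]
       | xiX in [set xiX | admissible p xiX.1 xiX.2]].

End NormsAndSpaces.

Definition compact_in_C (R : realType) (d : nat) (Omega : set 'rV[R]_d)
    (F : set ('rV[R]_d -> R)) : Prop :=
  (forall f, F f -> {within Omega, continuous f}) /\
  compact (F : set {uniform` Omega -> R}).

(* Main.v *)
Require Import Defs.
From HB Require Import structures.
From mathcomp Require Import all_boot all_order all_algebra.
From mathcomp Require Import all_classical all_reals all_analysis.
From mathcomp Require Import measurable_realfun.
From mathcomp Require Import lra ring.
Import Order.TTheory GRing.Theory Num.Theory.
Import numFieldNormedType.Exports.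
Local Open Scope classical_set_scope.
Local Open Scope ring_scope.
Set Implicit Arguments.
Unset Strict Implicit.
Unset Printing Implicit Defensive.

(** Write [N g] for the integral of |g|^p over Omega.  Recovery follows from a
one-sided sampling inequality: if [N g <= D * (mean of |g (xi i)|^p)] for all
[g] in the subspace [X], if [u] minimizes the empirical error of [f] over [X]
and if [g] in [X] satisfies |f - g| <= s, then the empirical means of
|f - u|^p and |f - g|^p are at most s^p, hence that of |g - u|^p is O(s^p),
and the sampling inequality turns this into a bound for [N (g - u)] and so for
[N (f - u)] ([recovery_bound]).  It remains to find such points, and only the
empirical norm being too small has to be excluded.

The points are drawn at random.  Condition NpB says |g|^p <= M * N g with
M = B^p n, and three ideas bound the number of points.

The unit ball of [X] has small entropy: on any r points it is covered, up to
t in the maximum norm, by (2r+1)^k functions with k of order M / t^p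
([unit_ball_net]).  This is proved by mirror descent with potential [N].  The
current guess nearly minimizes [N] minus a linear functional; a point where
the guess differs from [f] by more than t tilts the functional at that point.
By Clarkson's inequality [N] is uniformly convex of power type p, so every
such mistake lowers the gap between the energy of [f] and the minimal energy
by (t/4)^p / M.  The gap starts below 1, and the last guess depends only on
the list of mistakes.

For a single level t, a ghost sample and a random exchange of the two samples
reduce the event that some level set |f| > t receives too few points to a
union over the net of the 2m points ([undersampled_prob]).

For [N f] = 1 the integral of |f|^p is controlled by its layers at the dyadic
levels between 1/2 and M^(1/p).
There are J = O(log (2 B n)) of them, and the levels where t^p times the
probability of |f| > t is below a constant over J contribute little, so only
level sets of probability at least of order 1 / (J t^p) need enough points
([finite_discretization]).  Altogether m > C M J (log m + log J) suffices,
which is implied by m >= c B^p n (log (2 B n))^3 ([sample_size]).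

Randomness is used on a finite space only: by compactness Omega is replaced by
finitely many weighted points that control [N] on all of [X] at once, since
the coefficients of a function of [X] are bounded by its maximum
([coef_bound], [quadrature]). *)

(** * Powers of real numbers *)

Section Scalar.
Context (R : realType).
Implicit Types (a b x y p t : R).

Lemma ler_powR2r p x y : 0 <= p -> 0 <= x -> x <= y -> x `^ p <= y `^ p.
Proof.
move=> p0 x0 xy; apply: (ge0_ler_powR p0) => //; rewrite nnegrE //.
exact: le_trans xy.
Qed.

Lemma powR_le2r p x y : 0 < p -> 0 <= y -> 0 <= x -> x `^ p <= y `^ p -> x <= y.
Proof.
move=> p0 y0 x0; apply: contraTT; rewrite -!ltNge => yx.
by apply: gt0_ltr_powR => //; rewrite nnegrE.
Qed.

Lemma sqr_powR_half p x : 0 <= x -> (x ^+ 2) `^ (p / 2) = x `^ p.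
Proof.
move=> x0; rewrite -powR_mulrn // -powRrM; congr powR; by field.
Qed.

Lemma powR_invl p x : 0 <= x -> (x^-1) `^ p = (x `^ p)^-1.
Proof. by move=> x0; rewrite -powR_inv1 // -powRrM mulN1r powRN. Qed.

(** Add up x^p = x * x^(p-1) <= x * (x+y)^(p-1) and its analogue for y. *)
Lemma powR_superadd p x y : 1 <= p -> 0 <= x -> 0 <= y ->
  x `^ p + y `^ p <= (x + y) `^ p.
Proof.
move=> p1 x0 y0.
have p0 : 0 < p by lra.
have [s0|s0] := eqVneq (x + y) 0.
  have -> : x = 0 by lra.
  have -> : y = 0 by lra.
  by rewrite addr0 powR0 ?addr0 // lt0r_neq0.
have sp : 0 < x + y by rewrite lt0r s0 addr_ge0.
have key z : 0 <= z -> z <= x + y -> z `^ p <= z * (x + y) `^ (p - 1).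
  move=> z0 zs; rewrite -(mulr_powRB1 z0 p0) ler_wpM2l //.
  by apply: ler_powR2r => //; lra.
rewrite -(mulr_powRB1 (ltW sp) p0) mulrDl lerD // key //; lra.
Qed.

Lemma powR_mid p x y : 1 <= p -> 0 <= x -> 0 <= y ->
  ((x + y) / 2) `^ p <= (x `^ p + y `^ p) / 2.
Proof.
move=> p1 x0 y0.
have h0 : 0 <= 2^-1 :> R by rewrite invr_ge0.
have h1 : 2^-1 <= 1 :> R by rewrite invf_le1 // ler1n.
have := @convex_powR R p p1 (Itv01 h0 h1) x y.
rewrite !inE /= !in_itv /= !andbT => /(_ x0 y0).
have e : unstable.onem (2^-1 : R) = 2^-1 by rewrite /unstable.onem; field.
rewrite !convRE [X in X `^ _ <= _ -> _]convRE /= e.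
by rewrite -!mulrDr ![_ * 2^-1]mulrC.
Qed.

Lemma powR_add_le p x y : 0 <= p -> 0 <= x -> 0 <= y ->
  (x + y) `^ p <= 2 `^ p * (x `^ p + y `^ p).
Proof.
move=> p0; wlog xy : x y / x <= y.
  move=> H x0 y0; have [/H->//|/ltW/H] := lerP x y.
  by rewrite (addrC y) (addrC (y `^ p)); apply.
move=> x0 y0; apply: (@le_trans _ _ ((2 * y) `^ p)).
  by apply: ler_powR2r => //; lra.
by rewrite powRM // ler_wpM2l ?powR_ge0 // lerDr powR_ge0.
Qed.

Lemma le_absorb x a b : x <= a + b -> b <= x / 2 -> x <= 2 * a.
Proof. lra. Qed.

(** Squares obey the parallelogram identity; raising them to the power
p/2 >= 1 is superadditive on the left and convex on the right.  This scalar
form integrates to the uniform convexity of the p-th power of the norm. *)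
Lemma clarkson_scalar p a b : 2 <= p ->
  `|(a + b) / 2| `^ p + `|(a - b) / 2| `^ p <= (`|a| `^ p + `|b| `^ p) / 2.
Proof.
move=> p2; have p1 : 1 <= p / 2 by lra.
rewrite -(sqr_powR_half p (normr_ge0 ((a + b) / 2))).
rewrite -(sqr_powR_half p (normr_ge0 ((a - b) / 2))).
rewrite -(sqr_powR_half p (normr_ge0 a)) -(sqr_powR_half p (normr_ge0 b)).
rewrite !real_normK ?num_real //.
apply: le_trans (powR_superadd p1 (sqr_ge0 _) (sqr_ge0 _)) _.
apply: le_trans (powR_mid p1 (sqr_ge0 _) (sqr_ge0 _)).
by apply: ler_powR2r; [lra|rewrite addr_ge0 ?sqr_ge0|lra].
Qed.

Lemma expR_half_le2 : expR (2^-1) <= 2 :> R.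
Proof.
have := expR_ge1Dx (- (2^-1) : R); rewrite expRN => e.
have := ler_wpM2l (expR_ge0 (2^-1 : R)) e.
rewrite mulfV ?gt_eqF ?expR_gt0 //; lra.
Qed.

End Scalar.

(** * Nets of the unit ball from mirror descent *)

Section FiniteSpace.
Context (R : realType) (Y : finType) (w : Y -> R) (p : R).
Implicit Types (f g h : Y -> R) (theta : Y -> R).

Definition pmass f : R := \sum_y w y * `|f y| `^ p.

(** The potential of mirror descent, tilted by the linear functional of
density [theta]. *)
Definition energy theta f : R := pmass f - \sum_y theta y * f y.

Context (V : set (Y -> R)) (M : R).
Hypothesis p2 : 2 <= p.
Hypothesis w0 : forall y, 0 <= w y.
Hypothesis V0 : V (fun=> 0).
Hypothesis VC : forall a b f g, V f -> V g -> V (fun y => a * f y + b * g y).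
Hypothesis M0 : 0 < M.
Hypothesis nikolskii : forall f y, V f -> `|f y| `^ p <= M * pmass f.

Definition min_energy theta : R := inf [set energy theta f | f in V].

Let p0 : 0 < p. Proof. by apply: lt_le_trans p2. Qed.

Lemma pmass_ge0 f : 0 <= pmass f.
Proof. by apply: sumr_ge0 => y _; rewrite mulr_ge0 ?powR_ge0. Qed.

Lemma pmass_clarkson f g :
  pmass (fun y => 2^-1 * f y + 2^-1 * g y)
    + pmass (fun y => 2^-1 * f y + - 2^-1 * g y)
  <= (pmass f + pmass g) / 2.
Proof.
rewrite /pmass -!big_split /= mulr_suml; apply: ler_sum => y _.
rewrite -[X in X <= _]mulrDr -[X in _ <= X * _]mulrDr -mulrA ler_wpM2l //.
have := clarkson_scalar (f y) (g y) p2.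
have e1 : (f y + g y) / 2 = 2^-1 * f y + 2^-1 * g y by field.
have e2 : (f y - g y) / 2 = 2^-1 * f y + - 2^-1 * g y by field.
by rewrite e1 e2.
Qed.

(** Each value obeys |f y| <= l + |f y|^p / l^(p-1), so the linear term is
absorbed by [pmass] once l is large enough. *)
Lemma energy_lbound theta : has_lbound [set energy theta f | f in V].
Proof.
pose S : R := \sum_y `|theta y|; pose l : R := 1 + M * S.
have S0 : 0 <= S by apply: sumr_ge0.
have l1 : 1 <= l by rewrite lerDl mulr_ge0 // ltW.
have l0 : 0 < l by apply: lt_le_trans l1.
exists (- (l * S)) => _ [f Vf <-]; rewrite /energy.
have bnd y : `|f y| <= l + `|f y| `^ p / l.
  have [fl|fl] := lerP `|f y| l.
    by rewrite ler_wpDr // divr_ge0 ?powR_ge0 // ltW.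
  rewrite ler_wpDl ?(ltW l0) // ler_pdivlMr //.
  rewrite -(mulr_powRB1 (normr_ge0 _) p0) ler_wpM2l //.
  have : l <= `|f y| `^ (p - 1).
    apply: (le_trans (ltW fl)); apply: le1r_powR; last by have := p2; lra.
    exact: le_trans l1 (ltW fl).
  by [].
have : \sum_y theta y * f y <= S * (l + M * pmass f / l).
  rewrite mulr_suml; apply: ler_sum => y _.
  apply: (le_trans (ler_norm _)); rewrite normrM ler_wpM2l //.
  apply: (le_trans (bnd y)); rewrite lerD2l ler_wpM2r ?invr_ge0 ?(ltW l0) //.
  exact: nikolskii.
have : S * (M * pmass f / l) <= pmass f.
  rewrite mulrA ler_pdivrMr //.
  have -> : S * (M * pmass f) = pmass f * (M * S) by ring.
  by rewrite ler_wpM2l ?pmass_ge0 // lerDr.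
rewrite mulrDr (mulrC S l); lra.
Qed.

Lemma min_energy_le theta f : V f -> min_energy theta <= energy theta f.
Proof. by move=> Vf; apply: (ge_inf (energy_lbound theta)); exists f. Qed.

(** Near-minimizers are enough for the descent, which avoids proving that the
minimum is attained. *)
Lemma near_minimizer theta e : 0 < e ->
  exists2 h, V h & energy theta h < min_energy theta + e.
Proof.
move=> e0.
have [|_ [h Vh <-] he] := inf_adherent e0 (E := [set energy theta f | f in V]).
  by split; [exists (energy theta (fun=> 0)), (fun=> 0)|exact: energy_lbound].
by exists h.
Qed.

Lemma min_energy_ge theta c :
  (forall g, V g -> c <= energy theta g) -> c <= min_energy theta.
Proof.
move=> H; apply: lb_le_inf; first by exists (energy theta (fun=> 0)), (fun=> 0).
by move=> _ [g Vg <-]; apply: H.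
Qed.

(** Compare the minimal energy with the energy of the midpoint of [g] and [h]:
Clarkson's inequality quantifies how much the midpoint gains. *)
Lemma energy_convex theta h g e : V h -> V g ->
  energy theta h < min_energy theta + e ->
  min_energy theta + 2 * pmass (fun y => 2^-1 * g y + - 2^-1 * h y) - e
  <= energy theta g.
Proof.
move=> Vh Vg he.
have := min_energy_le theta (VC 2^-1 2^-1 Vg Vh).
have := pmass_clarkson g h; move: he; rewrite /energy.
have -> : \sum_y theta y * (2^-1 * g y + 2^-1 * h y) =
   2^-1 * (\sum_y theta y * g y) + 2^-1 * \sum_y theta y * h y.
  rewrite !mulr_sumr -big_split /=; apply: eq_bigr => y _; ring.
lra.
Qed.

Definition bump theta x c : Y -> R := fun y => theta y + c *+ (y == x).

Lemma energy_bump theta x c g :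
  energy (bump theta x c) g = energy theta g - c * g x.
Proof.
rewrite /energy /bump -addrA -opprD; congr (_ - _).
rewrite (eq_bigr (fun y => theta y * g y + c * g y *+ (y == x))); last first.
  by move=> y _; rewrite mulrDl mulrnAl.
rewrite big_split /=; congr (_ + _).
by rewrite (bigD1 x) //= eqxx big1 ?addr0 // => y /negbTE ->.
Qed.

Context (t : R).
Hypothesis t0 : 0 < t.

(** The tilt at a mistake: the largest value for which the growth
2 |u x|^p / M of the energy beats 2 * step * |u x| as soon as |u x| >= t/4. *)
Definition step : R := (t / 4) `^ (p - 1) / M.
(** The guaranteed decrease of the gap, [step * t / 4] (see [gainE]); it also
serves as the tolerance for near-minimizers. *)
Definition gain : R := (t / 4) `^ p / M.

Lemma gainE : gain = step * t / 4.
Proof.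
rewrite /gain /step -(@mulr_powRB1 _ (t/4) p) //; last by have := t0; lra.
by field; rewrite lt0r_neq0.
Qed.

Lemma step_gt0 : 0 < step.
Proof. by rewrite divr_gt0 // powR_gt0; have := t0; lra. Qed.

Lemma gain_gt0 : 0 < gain.
Proof. by rewrite divr_gt0 // powR_gt0; have := t0; lra. Qed.

(** Changing the functional at [x] could lower the minimum by moving the value
at [x] far from that of [h], but uniform convexity together with the pointwise
bound makes such a move cost more than it yields. *)
Lemma min_energy_bump theta h x c : V h -> `|c| = step ->
  energy theta h < min_energy theta + gain ->
  min_energy theta - c * h x - step * t / 2 - gain <= min_energy (bump theta x c).
Proof.
move=> Vh cs he; apply: min_energy_ge => g Vg.
rewrite energy_bump.
have := energy_convex Vh Vg he.
set u := fun y => _; have Vu : V u by apply: VC.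
have := nikolskii x Vu; set m := pmass u.
have ux : u x = (g x - h x) / 2 by rewrite /u; field.
have gx : g x = h x + 2 * u x by rewrite ux; field.
have : c * u x <= step * `|u x| by rewrite -cs -normrM ler_norm.
have key : 2 * (step * `|u x|) <= step * t / 2 + 2 * (`|u x| `^ p / M).
  have [ut|ut] := lerP `|u x| (t / 4).
    have := step_gt0; rewrite -(mulrC M^-1) => s0.
    have := ler_wpM2l (ltW s0) ut.
    have : 0 <= M^-1 * `|u x| `^ p by rewrite mulr_ge0 ?powR_ge0 // invr_ge0 ltW.
    lra.
  have : step * `|u x| <= `|u x| `^ p / M.
    rewrite -(mulr_powRB1 (normr_ge0 (u x)) p0) /step mulrC mulrA.
    rewrite ler_wpM2r ?invr_ge0 ?(ltW M0) // ler_wpM2l //.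
    by apply: ler_powR2r; have := p2; have := t0; lra.
  by have := mulr_gt0 step_gt0 t0; lra.
move=> cu; rewrite -ler_pdivrMl // mulrC => mu.
rewrite gx; lra.
Qed.

Lemma size_flatten_le (T U : Type) (F : T -> seq U) (s : seq T) N :
  (forall x, size (F x) <= N)%N ->
  (size (flatten [seq F x | x <- s]) <= size s * N)%N.
Proof.
move=> H; elim: s => //= x s IH.
by rewrite size_cat mulSn leq_add.
Qed.

Definition signed_step (b : bool) : R := if b then step else - step.

(** A mistake is progress: tilting towards [f] at [x] lowers the energy of [f]
by [step * t] more than the energy of [h], and by [min_energy_bump] only
[step * t / 2 + gain] of this is lost to the new minimum. *)
Lemma gap_bump theta h f x G : V h -> V f ->
  energy theta h < min_energy theta + gain -> t < `|f x - h x| ->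
  energy theta f <= min_energy theta + (G + gain) ->
  let theta' := bump theta x (signed_step (h x < f x)) in
  energy theta' f <= min_energy theta' + G.
Proof.
move=> Vh Vf he far fG /=; set c := signed_step _.
have s0 := step_gt0.
have cs : `|c| = step.
  by rewrite /c /signed_step; case: ifP; rewrite ?normrN gtr0_norm.
have cfar : step * t <= c * (f x - h x).
  have -> : c * (f x - h x) = step * `|f x - h x|.
    rewrite /c /signed_step; case: ltP => fh.
      by rewrite gtr0_norm // subr_gt0.
    by rewrite ler0_norm ?subr_le0 // mulrN mulNr.
  by rewrite ler_wpM2l // ltW.
rewrite energy_bump; have := min_energy_bump x Vh cs he.
move: fG cfar; rewrite gainE; lra.
Qed.

(** The net is the set of guesses met along all possible runs: from the current
guess, either no point of [P] is a mistake, or one of the 2 |P| signed points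
is used to tilt [theta], with one unit of gap less. *)
Lemma net_of_gap (P : seq Y) k theta : exists H : seq (Y -> R),
  (size H <= (2 * size P).+1 ^ k)%N /\
  forall f, V f -> energy theta f <= min_energy theta + k%:R * gain ->
    exists2 h, h \in H & {in P, forall x, `|f x - h x| <= t}.
Proof.
elim: k theta => [|k IH] theta; have [h Vh he] := near_minimizer theta gain_gt0.
  exists [:: h]; split => // f Vf fk; exists h; first by rewrite inE.
  move=> x xP; rewrite leNgt; apply/negP => far.
  have := @gap_bump theta h f x (- gain) Vh Vf he far.
  rewrite addNr addr0 => /(_ _) /=.
  have := min_energy_le (bump theta x (signed_step (h x < f x))) Vf.
  move: fk; rewrite mul0r addr0 => fk + /(_ fk); have := gain_gt0; lra.
have [H HP] := choice IH.
pose E := [seq (x, b) | x <- P, b <- [:: true; false]].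
pose next (e : Y * bool) := bump theta e.1 (signed_step e.2).
exists (h :: flatten [seq H (next e) | e <- E]); split.
  have := @size_flatten_le _ _ (fun e => H (next e)) E _ (fun e => (HP (next e)).1).
  rewrite /= size_allpairs /= (mulnC (size P)) expnS mulSn => sE.
  by rewrite -add1n leq_add // expn_gt0.
move=> f Vf fk.
have [close|] := pselect ({in P, forall x, `|f x - h x| <= t}).
  by exists h => //; rewrite inE eqxx.
move=> /existsNP[x /not_implyP[xP /negP]]; rewrite -ltNge => far.
have fk' : energy theta f <= min_energy theta + (k%:R * gain + gain).
  by move: fk; rewrite -natr1 mulrDl mul1r.
have := gap_bump Vh Vf he far fk' => /(HP (next (x, h x < f x))).2 .
case => // g gH gP; exists g => //; rewrite inE; apply/orP; right.
apply/flatten_mapP; exists (x, h x < f x) => //.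
by apply/allpairsP; exists (x, h x < f x); split => //=; case: (_ < _).
Qed.

(** The descent starts from [theta] = 0, where the gap is at most 1, so
1 / gain = M (4/t)^p rounds suffice. *)
Lemma unit_ball_net (P : seq Y) k : gain^-1 <= k%:R -> exists H : seq (Y -> R),
  (size H <= (2 * size P).+1 ^ k)%N /\
  forall f, V f -> pmass f <= 1 ->
    exists2 h, h \in H & {in P, forall x, `|f x - h x| <= t}.
Proof.
move=> kg; have [H [sH HP]] := net_of_gap P k (fun=> 0).
exists H; split => // f Vf f1; apply: HP => //.
have -> : energy (fun=> 0) f = pmass f.
  by rewrite /energy big1 ?subr0 // => y _; rewrite mul0r.
apply: (le_trans f1).
have I0 : 0 <= min_energy (fun=> 0).
  apply: min_energy_ge => g Vg; rewrite /energy big1 ?subr0 ?pmass_ge0 // => y _.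
  by rewrite mul0r.
by move: kg; rewrite -(ler_pM2r gain_gt0) mulVf ?gt_eqF ?gain_gt0 //; lra.
Qed.

End FiniteSpace.

(** * Sampling from a finite probability space *)

Section Sampling.
Context (R : realType) (Y : finType) (w : Y -> R) (m : nat).
Hypothesis w0 : forall y, 0 <= w y.
Hypothesis w1 : \sum_y w y = 1.
Implicit Types (xi eta : {ffun 'I_m -> Y}) (S : pred Y).

Definition weight xi : R := \prod_i w (xi i).
Definition wprob S : R := \sum_y w y * (S y)%:R.
Definition hits xi S : R := \sum_i (S (xi i))%:R.

Lemma weight_ge0 xi : 0 <= weight xi.
Proof. exact: prodr_ge0. Qed.

(** Independence of the coordinates of a sample. *)
Lemma sum_weightM (g : Y -> R) :
  \sum_xi weight xi * \prod_i g (xi i) = (\sum_y w y * g y) ^+ m.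
Proof.
under eq_bigr do rewrite -big_split /=.
rewrite -(bigA_distr_bigA (fun (i : 'I_m) y => w y * g y)) /=.
by rewrite prodr_const card_ord.
Qed.

Lemma sum_weight : \sum_xi weight xi = 1.
Proof.
have := sum_weightM (fun=> 1).
rewrite (eq_bigr w) => [|y _]; last by rewrite mulr1.
by rewrite w1 expr1n => <-; apply: eq_bigr => xi _; rewrite big1 ?mulr1.
Qed.

Lemma hits_ge0 xi S : 0 <= hits xi S.
Proof. exact: sumr_ge0. Qed.

Lemma expRN1_half : expR (- 1) <= 2^-1 :> R.
Proof.
rewrite expRN lef_pV2 ?posrE ?expR_gt0 //.
by have := expR_ge1Dx (1 : R).
Qed.

(** Chernoff's method with the exponential moment at -1. *)
Lemma hits_lower_tail S : 4 <= m%:R * wprob S ->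
  \sum_xi weight xi * (hits xi S < m%:R * wprob S / 4)%R%:R <= 2^-1.
Proof.
move=> big; set mu := m%:R * wprob S.
pose g y : R := expR (- (S y)%:R).
apply: (@le_trans _ _ (\sum_xi expR (mu / 4) * (weight xi * \prod_i g (xi i)))).
  apply: ler_sum => xi _; rewrite mulrCA ler_wpM2l ?weight_ge0 //.
  have -> : \prod_i g (xi i) = expR (- hits xi S).
    by rewrite /g -expR_sum -sumrN.
  rewrite -expRD; case: ltrP => [low|_]; last exact: expR_ge0.
  by rewrite -[leLHS]expR0 ler_expR; lra.
rewrite -mulr_sumr sum_weightM.
have one : \sum_y w y * g y <= expR (- (wprob S / 2)).
  apply: le_trans (expR_ge1Dx _).
  have -> : 1 + - (wprob S / 2) = \sum_y w y * (1 - (S y)%:R / 2).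
    under eq_bigr do rewrite mulrBr mulr1 mulrA.
    by rewrite sumrB w1 -mulr_suml.
  apply: ler_sum => y _.
  rewrite ler_wpM2l // /g; case: (S y) => /=; last by rewrite oppr0 expR0; lra.
  by apply: le_trans expRN1_half _; lra.
have nn : 0 <= \sum_y w y * g y by apply: sumr_ge0 => y _; rewrite mulr_ge0 ?expR_ge0.
have onem : (\sum_y w y * g y) ^+ m <= expR (- (mu / 2)).
  have -> : - (mu / 2) = m%:R * (- (wprob S / 2)).
    by rewrite /mu; field.
  by rewrite expRM_natl lerXn2r // nnegrE ?expR_ge0.
apply: (le_trans (ler_wpM2l (expR_ge0 _) onem)).
rewrite -expRD; apply: le_trans expRN1_half.
by rewrite ler_expR; move: big; rewrite -/mu; lra.
Qed.

(** [swap s xi eta] and [swap s eta xi] are the two samples after exchanging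
the coordinates selected by [s]. *)
Definition swap (s : {ffun 'I_m -> bool}) xi eta : {ffun 'I_m -> Y} :=
  [ffun i => if s i then eta i else xi i].

(** The weight 2 on the first sample makes the exponential moment at 1/4 of
the difference at most 1 for a fair exchange of each pair: when exactly one
point of the pair lies in [S] it is at most (4/3 + 2/3) / 2. *)
Lemma swap_tail S xi eta (r : R) :
  \sum_s (r <= hits (swap s eta xi) S - 2 * hits (swap s xi eta) S)%R%:R
  <= 2 ^+ m * expR (- (r / 4)).
Proof.
pose g (i : 'I_m) (b : bool) : R := let a := S (if b then eta i else xi i) in
  let a' := S (if b then xi i else eta i) in expR ((a'%:R - 2 * a%:R) / 4).
apply: (@le_trans _ _ (\sum_(s : {ffun 'I_m -> bool})
    expR (- (r / 4)) * \prod_i g i (s i))).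
  apply: ler_sum => s _.
  have -> : \prod_i g i (s i) =
      expR ((hits (swap s eta xi) S - 2 * hits (swap s xi eta) S) / 4).
    rewrite /g -expR_sum; congr expR.
    rewrite /hits mulr_sumr -sumrB mulr_suml; apply: eq_bigr => i _.
    by rewrite !ffunE.
  rewrite -expRD; case: (lerP r _) => [rl|_]; last exact: expR_ge0.
  by rewrite -[leLHS]expR0 ler_expR; lra.
rewrite -mulr_sumr mulrC ler_wpM2r ?expR_ge0 //.
rewrite -(bigA_distr_bigA g) /= -[X in _ <= _ ^+ X](card_ord m) -prodr_const.
apply: ler_prod => i _; rewrite big_bool /= addr_ge0 ?expR_ge0 //=.
have e14 : expR (1 / 4) <= 4 / 3 :> R.
  have := expR_ge1Dx (- (1 / 4) : R); rewrite expRN => e.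
  have := ler_wpM2l (expR_ge0 (1 / 4 : R)) e.
  rewrite mulfV ?gt_eqF ?expR_gt0 //; lra.
have e12 : expR (- (2 / 4)) <= 2 / 3 :> R.
  have := expR_ge1Dx (2 / 4 : R); rewrite expRN => e.
  have := ler_wpM2l (expR_ge0 (- (2 / 4) : R)) e.
  rewrite expRN mulVf ?gt_eqF ?expR_gt0 //; lra.
have em : expR (- (1 / 4)) <= 1 :> R by rewrite -[leRHS]expR0 ler_expR; lra.
rewrite /g /=; case: (S (xi i)); case: (S (eta i)) => /=.
- have -> : (1%:R - 2 * 1%:R) / 4 = - (1 / 4) :> R by field.
  lra.
- have -> : (1%:R - 2 * 0%:R) / 4 = 1 / 4 :> R by field.
  have -> : (0%:R - 2 * 1%:R) / 4 = - (2 / 4) :> R by field.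
  lra.
- have -> : (1%:R - 2 * 0%:R) / 4 = 1 / 4 :> R by field.
  have -> : (0%:R - 2 * 1%:R) / 4 = - (2 / 4) :> R by field.
  lra.
- by rewrite mulr0 subr0 mul0r expR0.
Qed.

(** Exchanging coordinates is an involution on pairs of samples that preserves
the product of their weights. *)
Lemma sum_weight_swap (F : {ffun 'I_m -> Y} -> {ffun 'I_m -> Y} -> R) s :
  \sum_xi \sum_eta weight xi * weight eta * F (swap s xi eta) (swap s eta xi)
  = \sum_xi \sum_eta weight xi * weight eta * F xi eta.
Proof.
rewrite !pair_big /=.
pose h (z : {ffun 'I_m -> Y} * {ffun 'I_m -> Y}) :=
  (swap s z.1 z.2, swap s z.2 z.1).
have hK : involutive h.
  by case=> a b; congr pair; apply/ffunP => i; rewrite !ffunE; case: (s i).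
rewrite [RHS](reindex_inj (inv_inj hK)) /=; apply: eq_bigr => -[a b] _ /=.
congr (_ * _); rewrite /weight -!big_split /=; apply: eq_bigr => i _.
by rewrite !ffunE; case: (s i) => //; rewrite mulrC.
Qed.

End Sampling.

(** * One level set: ghost sample and random exchange *)

Section Discretization.
Context (R : realType) (Y : finType) (w : Y -> R) (p : R) (V : set (Y -> R)) (M : R).
Hypothesis p2 : 2 <= p.
Hypothesis w0 : forall y, 0 <= w y.
Hypothesis w1 : \sum_y w y = 1.
Hypothesis V0 : V (fun=> 0).
Hypothesis VC : forall a b f g, V f -> V g -> V (fun y => a * f y + b * g y).
Hypothesis M1 : 1 <= M.
Hypothesis nikolskii : forall f y, V f -> `|f y| `^ p <= M * pmass w p f.
Context (m : nat).
Implicit Types (xi eta : {ffun 'I_m -> Y}) (f g h : Y -> R) (t q : R).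

Let p0 : 0 < p. Proof. by apply: lt_le_trans p2. Qed.
Let M0 : 0 < M. Proof. by apply: lt_le_trans M1. Qed.

Definition above f t : pred Y := fun y => t < `|f y|.

(** The event to be excluded at level [t].  The level is halved for the sample
so that functions may be replaced by their approximants, and the constant
1/16 makes room for a ghost sample to get four times as many points even if it
gets only a quarter of the expected number. *)
Definition undersampled t q xi : Prop := exists f, [/\ V f, pmass w p f <= 1,
  q <= wprob w (above f t) &
  hits R xi (above f (t / 2)) < m%:R * wprob w (above f t) / 16].

(** The symmetrized event: a ghost sample [eta] sees the level set where the
sample [xi] does not; the probability of the set no longer occurs. *)
Definition unbalanced t q xi eta : Prop := exists f, [/\ V f, pmass w p f <= 1,
  m%:R * q / 4 <= hits R eta (above f t) &
  hits R xi (above f (t / 2)) <= hits R eta (above f t) / 4].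

(** For the function that witnesses [undersampled], an independent sample hits
the level set about as often as expected with probability at least 1/2. *)
Lemma ghost_sample t q xi : 4 <= m%:R * q -> undersampled t q xi ->
  2^-1 <= \sum_eta weight w eta * `[< unbalanced t q xi eta >]%:R.
Proof.
move=> big [f [Vf f1 qf few]].
set S := above f t in qf few.
have bigS : 4 <= m%:R * wprob w S.
  by apply: (le_trans big); rewrite ler_wpM2l.
apply: (@le_trans _ _ (\sum_eta weight w eta *
    (1 - (hits R eta S < m%:R * wprob w S / 4)%R%:R))).
  under eq_bigr do rewrite mulrBr mulr1.
  rewrite sumrB sum_weight //.
  by have := @hits_lower_tail R Y w m w0 w1 S bigS; lra.
apply: ler_sum => eta _; rewrite ler_wpM2l ?weight_ge0 //.
case: (ltrP (hits R eta S) _) => [_|many]; first by rewrite subrr.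
rewrite subr0; case: asboolP => // -[]; exists f; split=> //.
  by apply: le_trans many; rewrite ler_wpM2r // ler_wpM2l.
by rewrite -/S; lra.
Qed.

(** With the two samples fixed, all functions may be replaced by members of a
net for the 2m points, which is insensitive to exchanges; the level 3t/4 lies
between t/2 and t at distance t/4 from both. *)
Lemma swapped_unbalanced t q k xi eta : 0 < t -> M * (16 / t) `^ p <= k%:R ->
  \sum_s `[< unbalanced t q (swap s xi eta) (swap s eta xi) >]%:R
  <= (4 * m).+1%:R ^+ k * (2 ^+ m * expR (- (m%:R * q / 32))) :> R.
Proof.
move=> t0 kM; pose P := codom xi ++ codom eta.
have sP : (2 * size P = 4 * m)%N.
  by rewrite size_cat !size_codom card_ord addnn -mul2n mulnA.
have t40 : 0 < t / 4 by lra.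
have kg : (gain p M (t / 4))^-1 <= k%:R.
  apply: le_trans kM; rewrite /gain invf_div ler_wpM2l ?(ltW M0) //.
  have -> : 16 / t = (t / 4 / 4)^-1 by field; rewrite gt_eqF.
  by rewrite powR_invl //; lra.
have [H [sH HP]] :=
  @unit_ball_net R Y w p V M p2 w0 V0 VC M0 nikolskii (t / 4) t40 P k kg.
pose S (h : Y -> R) := above h (3 * t / 4).
apply: (@le_trans _ _ (\sum_s \sum_(h <- H)
    (m%:R * q / 8 <=
     hits R (swap s eta xi) (S h) - 2 * hits R (swap s xi eta) (S h))%R%:R)).
  apply: ler_sum => s _; case: asboolP => [[f [Vf f1 many few]]|_]; last first.
    by apply: sumr_ge0.
  have [h hH close] := HP f Vf f1.
  have inP i : (swap s xi eta i \in P) /\ (swap s eta xi i \in P).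
    by rewrite !ffunE /P !mem_cat; case: (s i); rewrite !codom_f ?orbT.
  have hb : hits R (swap s eta xi) (above f t) <= hits R (swap s eta xi) (S h).
    apply: ler_sum => i _; rewrite ler_nat /above /S /above.
    have := close _ (inP i).2; set y := swap s eta xi i => c.
    case: (ltrP t) => // tf; have -> // : 3 * t / 4 < `|h y|.
    have := ler_distD (h y) (f y) 0; rewrite !subr0; lra.
  have ha : hits R (swap s xi eta) (S h) <= hits R (swap s xi eta) (above f (t / 2)).
    apply: ler_sum => i _; rewrite ler_nat /above /S /above.
    have := close _ (inP i).1; set y := swap s xi eta i => c.
    case: (ltrP (3 * t / 4)) => // tf; have -> // : t / 2 < `|f y|.
    have := ler_distD (f y) (h y) 0; rewrite !subr0 (distrC (h y)); lra.
  rewrite (big_rem h) //=.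
  have -> : m%:R * q / 8 <=
    hits R (swap s eta xi) (S h) - 2 * hits R (swap s xi eta) (S h) by lra.
  by rewrite lerDl; apply: sumr_ge0.
rewrite exchange_big /=.
apply: (@le_trans _ _ (\sum_(h <- H) 2 ^+ m * expR (- (m%:R * q / 32)))).
  apply: ler_sum => h _; apply: le_trans (swap_tail _ _ _ _) _.
  by rewrite ler_wpM2l ?exprn_ge0 // ler_expR; lra.
rewrite big_const_seq count_predT iter_addr_0 -[leLHS]mulr_natl ler_wpM2r //.
by rewrite -natrX ler_nat -sP.
Qed.

Lemma undersampled_prob t q k : 0 < t -> M * (16 / t) `^ p <= k%:R ->
  4 <= m%:R * q ->
  \sum_xi weight w xi * `[< undersampled t q xi >]%:R
  <= 2 * ((4 * m).+1%:R ^+ k * expR (- (m%:R * q / 32))).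
Proof.
move=> t0 kM big.
pose X : R := \sum_xi \sum_eta
  weight w xi * weight w eta * `[< unbalanced t q xi eta >]%:R.
have lX : \sum_xi weight w xi * `[< undersampled t q xi >]%:R <= 2 * X.
  rewrite mulr_sumr; apply: ler_sum => xi _.
  have -> : \sum_eta weight w xi * weight w eta * `[< unbalanced t q xi eta >]%:R
      = weight w xi * \sum_eta weight w eta * `[< unbalanced t q xi eta >]%:R :> R.
    by rewrite mulr_sumr; apply: eq_bigr => eta _; rewrite mulrA.
  rewrite mulrCA ler_wpM2l ?weight_ge0 //.
  case: asboolP => [/(ghost_sample big)|_]; first by rewrite mulr1n; lra.
  by rewrite mulr_ge0 // sumr_ge0 // => eta _; rewrite mulr_ge0 ?weight_ge0.
apply: (le_trans lX); rewrite ler_wpM2l //.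
have e2m : 0 < 2 ^+ m :> R by rewrite exprn_gt0.
rewrite -(ler_pM2l e2m).
have -> : 2 ^+ m * X = \sum_(s : {ffun 'I_m -> bool}) X.
  by rewrite sumr_const card_ffun card_bool card_ord -[RHS]mulr_natl natrX.
pose F xi eta : R := `[< unbalanced t q xi eta >]%:R.
rewrite (eq_bigr (fun s => \sum_xi \sum_eta weight w xi * weight w eta *
    F (swap s xi eta) (swap s eta xi))); last first.
  by move=> s _; rewrite sum_weight_swap.
rewrite exchange_big /=; set B := _ ^+ k * _.
apply: (@le_trans _ _ (\sum_xi weight w xi * (2 ^+ m * B))); last first.
  by rewrite -mulr_suml sum_weight // mul1r.
apply: ler_sum => xi _; rewrite exchange_big /=.
apply: (@le_trans _ _
    (\sum_eta weight w eta * (weight w xi * (2 ^+ m * B)))); last first.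
  by rewrite -mulr_suml sum_weight // mul1r.
apply: ler_sum => eta _; rewrite -mulr_sumr mulrA (mulrC (weight w eta)).
rewrite ler_wpM2l ?mulr_ge0 ?weight_ge0 // /B mulrCA.
exact: swapped_unbalanced.
Qed.

End Discretization.

(** * Dyadic levels and discretization on a finite space *)

Section DyadicLevels.
Context (R : realType) (p : R).
Hypothesis p2 : 2 <= p.
Implicit Types (a : R) (j J : nat).

Definition level j : R := 2 ^+ j / 2.

Lemma level_gt0 j : 0 < level j.
Proof. by rewrite divr_gt0 // exprn_gt0. Qed.

Lemma levelS j : level j.+1 = 2 * level j.
Proof. by rewrite /level exprS mulrA. Qed.

Lemma level_powS j : level j.+1 `^ p = 2 `^ p * level j `^ p.
Proof. by rewrite levelS powRM // ltW // level_gt0. Qed.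

Let p0 : 0 <= p. Proof. by apply: le_trans p2. Qed.

Lemma pow2_ge2 : 2 <= 2 `^ p :> R.
Proof. by apply: le1r_powR; [lra | have := p2; lra]. Qed.

(** Layer-cake estimate: between consecutive levels |a|^p changes by the factor
2^p only, and below the first level it is at most 1/4. *)
Lemma layer_le a J : 0 <= a -> a <= level J ->
  a `^ p <= 4^-1 + 2 `^ p * \sum_(j < J) level j `^ p * (level j < a)%R%:R.
Proof.
move=> a0; elim: J => [|J IH] aJ.
  rewrite big_ord0 mulr0 addr0.
  apply: (@le_trans _ _ (2^-1 `^ p)).
    by apply: ler_powR2r => //; move: aJ; rewrite /level expr0 mul1r.
  apply: (@le_trans _ _ (2^-1 `^ 2%:R)).
    by apply: ger_powR => //; rewrite invr_gt0 invf_le1 //; lra.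
  by rewrite powR_mulrn //; lra.
rewrite big_ord_recr /= mulrDr.
case: (ltrP (level J) a) => [Ja|/IH]; last by rewrite mulr0 mulr0 addr0.
rewrite mulr1 -level_powS addrA ler_wpDl //; last exact: ler_powR2r.
rewrite addr_ge0 ?invr_ge0 // mulr_ge0 ?powR_ge0 // sumr_ge0 // => j _.
by rewrite mulr_ge0 ?powR_ge0.
Qed.

Lemma sum_level J : \sum_(j < J.+1) level j `^ p <= 2 * level J `^ p.
Proof.
elim: J => [|J IH].
  by rewrite big_ord_recr /= big_ord0 add0r; have := powR_ge0 (level 0) p; lra.
rewrite big_ord_recr /= level_powS.
have := ler_wpM2r (powR_ge0 (level J) p) pow2_ge2; move: IH; lra.
Qed.

(** Conversely the layers sum up geometrically, dominated by the last level
below 2a. *)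
Lemma layer_ge a J : 0 <= a ->
  \sum_(j < J) level j `^ p * (level j / 2 < a)%R%:R <= 2 * (2 `^ p * a `^ p).
Proof.
move=> a0; have nn : 0 <= 2 * (2 `^ p * a `^ p).
  by rewrite !mulr_ge0 ?powR_ge0.
elim: J => [|J IH]; first by rewrite big_ord0.
case: (ltrP (level J / 2) a) => [Ja|Ja]; last first.
  by rewrite big_ord_recr /= ltNge Ja mulr0 addr0.
apply: le_trans (_ : \sum_(j < J.+1) level j `^ p <= _).
  apply: ler_sum => j _; rewrite -[leRHS]mulr1 ler_wpM2l ?powR_ge0 //.
  by rewrite lern1 leq_b1.
apply: (le_trans (sum_level J)); rewrite ler_wpM2l // -powRM //.
by apply: ler_powR2r => //; [exact: ltW (level_gt0 _)|lra].
Qed.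

End DyadicLevels.

Section FiniteDiscretization.
Context (R : realType) (Y : finType) (w : Y -> R) (p : R) (V : set (Y -> R)) (M : R).
Hypothesis p2 : 2 <= p.
Hypothesis w0 : forall y, 0 <= w y.
Hypothesis w1 : \sum_y w y = 1.
Hypothesis V0 : V (fun=> 0).
Hypothesis VC : forall a b f g, V f -> V g -> V (fun y => a * f y + b * g y).
Hypothesis M1 : 1 <= M.
Hypothesis nikolskii : forall f y, V f -> `|f y| `^ p <= M * pmass w p f.
Context (m J : nat).
Hypothesis J0 : (0 < J)%N.
Hypothesis MJ : M <= level R J `^ p.
Hypothesis enough : 128 * J%:R * 2 `^ p * M *
  (ln (2 * J%:R) + 2 * 16 `^ p * ln (4 * m).+1%:R) < m%:R.

Let p0 : 0 < p. Proof. by apply: lt_le_trans p2. Qed.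
Let M0 : 0 < M. Proof. by apply: lt_le_trans M1. Qed.

(** The J levels together may lose sum_j level_j^p * quota_j = 2^(-p) / 4 of the
mass, one third of what [layer_le] leaves above the first level. *)
Definition quota (j : nat) : R := (2 `^ p)^-1 / (4 * J%:R) / level R j `^ p.

Lemma sample_size_gt0 : (0 < m)%N.
Proof.
rewrite -(ltr0n R); apply: le_lt_trans enough.
rewrite !mulr_ge0 ?powR_ge0 // ?(ltW M0) // addr_ge0 ?mulr_ge0 ?powR_ge0 // ln_ge0 //.
  by rewrite -natrM ler1n muln_gt0.
by rewrite ler1n.
Qed.

Lemma quota_gt0 j : 0 < quota j.
Proof.
by rewrite !divr_gt0 ?invr_gt0 ?powR_gt0 ?level_gt0 // mulr_gt0 ?ltr0n.
Qed.

(** Above M^(1/p) the level sets of the unit ball are empty. *)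
Lemma undersampled_high_level j (xi : {ffun 'I_m -> Y}) : M < level R j `^ p ->
  ~ undersampled w p V (level R j) (quota j) xi.
Proof.
move=> MT [f [Vf f1 + _]]; apply/negP; rewrite -ltNge.
suff -> : wprob w (above f (level R j)) = 0 by exact: quota_gt0.
apply: big1 => y _; rewrite /above ltNge (_ : _ <= _) ?mulr0 //.
apply: (@powR_le2r _ p) => //; first by rewrite ltW // level_gt0.
apply: (le_trans (nikolskii y Vf)); apply: le_trans (ltW MT).
by rewrite -[leRHS]mulr1 ler_wpM2l // ltW.
Qed.

(** Here the number of points is spent: the net has exp (k ln (4m+1)) elements
with k at most 2 M 16^p / level^p, against the exponent m quota / 32, which is
also inversely proportional to level^p. *)
Lemma undersampled_level j :
  \sum_(xi : {ffun 'I_m -> Y})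
    weight w xi * `[< undersampled w p V (level R j) (quota j) xi >]%:R
  < J%:R^-1.
Proof.
have JR : 0 < J%:R :> R by rewrite ltr0n.
set T := level R j `^ p; have T0 : 0 < T by rewrite powR_gt0 // level_gt0.
have [MT|TM] := ltrP M T.
  rewrite big1 ?invr_gt0 // => xi _.
  by rewrite asboolF ?mulr0 //; exact: undersampled_high_level.
pose Q : R := 16 `^ p; pose P : R := 2 `^ p.
have Q1 : 1 <= Q by rewrite -(powRr0 16); apply: ler_powR; [lra|exact: ltW].
have P0 : 0 < P by rewrite powR_gt0.
pose LN : R := ln (4 * m).+1%:R; pose LJ : R := ln (2 * J%:R).
have LJ0 : 0 <= LJ by apply: ln_ge0; rewrite -natrM ler1n muln_gt0.
have LN2 : 2^-1 <= LN.
  rewrite -(expRK 2^-1) ler_ln ?posrE ?expR_gt0 ?ltr0n //.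
  apply: (@le_trans _ _ 5%:R); last first.
    by rewrite ler_nat ltnS -[leqLHS]muln1 leq_pmul2l ?sample_size_gt0.
  by apply: (le_trans (expR_half_le2 R)); lra.
pose X := M * (16 / level R j) `^ p.
have XE : X * T = M * Q.
  rewrite /X powRM ?invr_ge0 ?(ltW (level_gt0 _ _)) //.
  by rewrite powR_invl ?(ltW (level_gt0 _ _)) // -mulrA divfK // gt_eqF.
have X1 : 1 <= X.
  rewrite -(ler_pM2r T0) XE mul1r; apply: (le_trans TM).
  by rewrite -[leLHS]mulr1 ler_wpM2l // ltW.
pose k := (Num.truncn X).+1.
have kX : X <= k%:R by rewrite ltW // /k truncnS_gt.
have k2X : k%:R <= 2 * X.
  have tX : (Num.truncn X)%:R <= X by rewrite truncn_le (le_trans _ X1).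
  by rewrite /k -natr1; lra.
have mq : m%:R * quota j / 32 = m%:R / (128 * J%:R * P * T).
  rewrite /quota -/T -/P; field.
  by rewrite !gt_eqF.
have key : LJ + k%:R * LN < m%:R * quota j / 32.
  rewrite mq ltr_pdivlMr ?mulr_gt0 //; apply: le_lt_trans enough.
  have kT : k%:R * T <= 2 * M * Q by rewrite -mulrA -XE mulrA ler_wpM2r // ltW.
  have h1 : T * LJ <= M * LJ by rewrite ler_wpM2r.
  have h2 : k%:R * T * LN <= 2 * M * Q * LN by rewrite ler_wpM2r //; lra.
  have -> : (LJ + k%:R * LN) * (128 * J%:R * P * T)
    = (128 * J%:R * P) * (T * LJ + k%:R * T * LN) by ring.
  rewrite -/P -/Q -/LN -/LJ -[leRHS]mulrA ler_wpM2l ?mulr_ge0 // ?(ltW P0) //; lra.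
have big : 4 <= m%:R * quota j.
  have : LN <= k%:R * LN by rewrite -[leLHS]mul1r ler_wpM2r ?ler1n //; lra.
  lra.
apply: le_lt_trans
  (undersampled_prob p2 w0 w1 V0 VC M1 nikolskii (level_gt0 _ _) kX big) _.
have -> : (4 * m).+1%:R ^+ k = expR (k%:R * LN).
  by rewrite expRM_natl lnK // posrE ltr0n.
rewrite -expRD -(ltr_pM2l JR) mulfV ?gt_eqF // mulrA (mulrC _ 2).
have -> : 2 * J%:R = expR LJ by rewrite lnK // posrE mulr_gt0.
by rewrite -expRD -[ltRHS]expR0 ltr_expR; lra.
Qed.

(** Union bound over the levels. *)
Lemma good_sample : exists xi : {ffun 'I_m -> Y},
  forall j, (j < J)%N -> ~ undersampled w p V (level R j) (quota j) xi.
Proof.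
apply: contrapT => /forallNP none.
have : \sum_(xi : {ffun 'I_m -> Y}) weight w xi <=
    \sum_(j < J) \sum_(xi : {ffun 'I_m -> Y})
   weight w xi * `[< undersampled w p V (level R j) (quota j) xi >]%:R.
  rewrite exchange_big /=; apply: ler_sum => xi _.
  have /existsNP[j /not_implyP[jJ /contrapT bad]] := none xi.
  rewrite (bigD1 (Ordinal jJ)) //= asboolT // mulr1 lerDl sumr_ge0 // => i _.
  by rewrite mulr_ge0 ?weight_ge0.
rewrite sum_weight // leNgt => /negP; apply.
apply: (@lt_le_trans _ _ (\sum_(j < J) J%:R^-1)).
  apply: ltr_sum; first by apply/hasP; exists (Ordinal J0); rewrite ?mem_index_enum.
  by move=> j _; exact: undersampled_level.
by rewrite sumr_const card_ord -[leLHS]mulr_natl mulfV // pnatr_eq0 -lt0n.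
Qed.

Lemma sample_unit (xi : {ffun 'I_m -> Y}) f : V f -> pmass w p f = 1 ->
  (forall j, (j < J)%N -> ~ undersampled w p V (level R j) (quota j) xi) ->
  1 <= 64 * (2 `^ p * 2 `^ p) / m%:R * \sum_(i < m) `|f (xi i)| `^ p.
Proof.
move=> Vf f1 good; have m0 := sample_size_gt0.
pose T j := level R j `^ p; pose P : R := 2 `^ p.
have P0 : 0 < P by rewrite powR_gt0.
have T0 j : 0 < T j by rewrite powR_gt0 // level_gt0.
have mR : 0 < m%:R :> R by rewrite ltr0n.
pose W j := wprob w (above f (level R j)).
pose A := \sum_(i < m) `|f (xi i)| `^ p.
have hA : \sum_(j < J) T j * hits R xi (above f (level R j / 2)) <= 2 * P * A.
  under eq_bigr do rewrite /hits mulr_sumr.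
  rewrite exchange_big mulr_sumr /=; apply: ler_sum => i _.
  by rewrite -mulrA; apply: layer_ge.
have hits_lb : forall j : 'I_J,
    m%:R / 16 * (W j - quota j) <= hits R xi (above f (level R j / 2)).
  move=> j; have [qW|qW] := lerP (quota j) (W j); last first.
    by apply: le_trans (hits_ge0 _ _ _); rewrite mulr_ge0_le0 ?subr_le0 ?(ltW qW) //.
  have q0 : 0 <= quota j.
    by rewrite /quota !divr_ge0 ?invr_ge0 ?powR_ge0 ?mulr_ge0.
  apply: (@le_trans _ _ (m%:R * W j / 16)).
    by have := mulr_ge0 (ltW mR) q0; lra.
  rewrite leNgt; apply/negP => few; apply: (good j (ltn_ord j)).
  by exists f; split => //; rewrite f1.
have hS : 1 <= 4^-1 + P * \sum_(j < J) T j * W j.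
  rewrite -[leLHS]f1 /pmass.
  apply: (@le_trans _ _ (\sum_y w y *
      (4^-1 + P * \sum_(j < J) T j * (level R j < `|f y|)%R%:R))).
    apply: ler_sum => y _; rewrite ler_wpM2l //; apply: layer_le => //.
    apply: (@powR_le2r _ p) => //; first by rewrite ltW // level_gt0.
    by apply: le_trans MJ; have := nikolskii y Vf; rewrite f1 mulr1.
  under eq_bigr do rewrite mulrDr.
  rewrite big_split /= -[X in X + _ <= _]mulr_suml w1 mul1r lerD2l.
  under eq_bigr do rewrite mulrCA mulr_sumr.
  rewrite -mulr_sumr exchange_big /= ler_wpM2l ?(ltW P0) //.
  apply: ler_sum => j _; rewrite /W /wprob mulr_sumr; apply: ler_sum => y _.
  by rewrite mulrCA.
have hq : \sum_(j < J) T j * quota j = P^-1 / 4.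
  rewrite (eq_bigr (fun=> P^-1 / (4 * J%:R))) => [|j _].
    rewrite sumr_const card_ord -[LHS]mulr_natl; field.
    by rewrite gt_eqF // gt_eqF // ltr0n.
  by rewrite /quota mulrC divfK // (gt_eqF (T0 j)).
have : m%:R / 16 * (\sum_(j < J) T j * W j - P^-1 / 4) <= 2 * P * A.
  apply: le_trans hA; rewrite -hq -sumrB mulr_sumr; apply: ler_sum => j _.
  by rewrite -mulrBr mulrCA ler_wpM2l ?(ltW (T0 _)).
set S := \sum_(j < J) T j * W j in hS * => /(ler_wpM2l (ltW P0)).
have -> : P * (m%:R / 16 * (S - P^-1 / 4)) = m%:R / 16 * (P * S - 4^-1).
  by field; rewrite gt_eqF.
have : m%:R / 16 * 2^-1 <= m%:R / 16 * (P * S - 4^-1).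
  by rewrite ler_wpM2l ?divr_ge0 //; lra.
move=> h1 h2; rewrite -/A mulrAC ler_pdivlMr // mul1r.
by have := le_trans h1 h2; rewrite -/P; lra.
Qed.

(** By homogeneity it suffices to treat functions of unit mass. *)
Theorem finite_discretization : exists xi : 'I_m -> Y, forall f, V f ->
  pmass w p f <= 64 * (2 `^ p * 2 `^ p) / m%:R * \sum_(i < m) `|f (xi i)| `^ p.
Proof.
have [xi good] := good_sample; exists xi => f Vf.
have nn := pmass_ge0 p w0 f.
have [z|nz] := eqVneq (pmass w p f) 0.
  rewrite z; apply: mulr_ge0; first by rewrite divr_ge0 // !mulr_ge0 // powR_ge0.
  by apply: sumr_ge0 => i _; exact: powR_ge0.
have s0 : 0 < pmass w p f by rewrite lt0r nz.
set s := pmass w p f in nn nz s0 *.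
pose c := s `^ (- p^-1); pose g y := c * f y + 0 * f y.
have Vg : V g by apply: VC.
have c0 : 0 <= c by exact: powR_ge0.
have gE y : `|g y| `^ p = s^-1 * `|f y| `^ p.
  rewrite /g mul0r addr0 normrM powRM // (ger0_norm c0) /c -powRrM.
  by rewrite mulNr mulVf ?gt_eqF // powR_inv1.
have g1 : pmass w p g = 1.
  rewrite /pmass (eq_bigr (fun y => s^-1 * (w y * `|f y| `^ p))).
    by rewrite -mulr_sumr mulVf.
  by move=> y _; rewrite gE mulrCA.
have := sample_unit Vg g1 good.
under eq_bigr do rewrite gE.
by rewrite -mulr_sumr mulrCA ler_pdivlMl // mulr1.
Qed.

End FiniteDiscretization.

(** * Finite-dimensional spaces of functions and p-th power integrals *)

Section NormEquivalence.
Context (R : realType) (T : Type) (Omega : set T) (n : nat) (u : 'I_n -> T -> R).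
Hypothesis indep : forall a, (forall x, Omega x -> lincomb u a x = 0) ->
  forall i, a i = 0.

Definition sample_mx N (x : 'I_N -> T) : 'M[R]_(N, n) :=
  \matrix_(j, i) u i (x j).

Lemma sample_mxE N (x : 'I_N -> T) (v : 'cV[R]_n) j :
  (sample_mx x *m v) j 0 = lincomb u (fun i => v i 0) (x j).
Proof.
by rewrite mxE /lincomb; apply: eq_bigr => i _; rewrite mxE mulrC.
Qed.

(** Points whose evaluation matrix has maximal rank: were the rank below n, a
vector of coefficients in the kernel would vanish at all of them, and adding a
point where its combination does not vanish would increase the rank. *)
Lemma unisolvent_points : exists N (x : 'I_N -> T),
  (forall j, Omega (x j)) /\ row_full (sample_mx x).
Proof.
pose P (r : nat) := `[< exists N (x : 'I_N -> T),
  (forall j, Omega (x j)) /\ \rank (sample_mx x) = r >].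
have exP : exists r, P r.
  have /choice[x0 _] : forall j : 'I_0, exists y : T, True by case.
  by exists (\rank (sample_mx x0)); apply/asboolP; exists 0%N, x0; split => // -[].
have ubP r : P r -> (r <= n)%N.
  by move=> /asboolP[N [x [_ <-]]]; exact: rank_leq_col.
case: (ex_maxnP exP ubP) => r /asboolP[N [x [xO rx]]] maxr.
exists N, x; split => //; rewrite /row_full rx eqn_leq; apply/andP; split.
  by rewrite -rx rank_leq_col.
rewrite leqNgt; apply/negP => rn.
set A := sample_mx x in rx.
have : cokermx A != 0 by rewrite -mxrank_eq0 mxrank_coker rx subn_eq0 -ltnNge.
have [|/forallNP all0] := pselect (exists k, col k (cokermx A) != 0); last first.
  move=> /eqP[]; apply/matrixP => i k; rewrite [RHS]mxE.
  have /negP/negbNE/eqP/matrixP/(_ i 0) := all0 k.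
  by rewrite !mxE.
move=> [k ck] _; set v := col k _ in ck.
have [x0 [Ox0 fx0]] : exists x0, Omega x0 /\ lincomb u (fun i => v i 0) x0 <> 0.
  apply: contrapT => /forallNP none; move/eqP: ck; apply.
  apply/matrixP => i j; rewrite ord1 [RHS]mxE.
  apply: (@indep (fun i => v i 0)) => y Oy; apply: contrapT => ne.
  exact: (none y).
pose x' (j : 'I_(N + 1)) : T :=
  match fintype.split j with inl j' => x j' | inr _ => x0 end.
have Ax' : sample_mx x' = col_mx A (\row_i u i x0).
  apply/matrixP => j i; rewrite !mxE /x'.
  by case: (fintype.split j) => j'; rewrite !mxE.
have sub : (A <= sample_mx x')%MS by rewrite Ax' -addsmxE addsmxSl.
have nsub : ~~ (sample_mx x' <= A)%MS.
  rewrite Ax' col_mx_sub submx_refl /= submxE; apply/negP => /eqP z.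
  apply: fx0; rewrite /lincomb; have /matrixP/(_ 0 k) := z.
  rewrite mxE [RHS]mxE => z0; apply: etrans z0; apply: eq_bigr => i _.
  by rewrite /v !mxE mulrC.
have lt : (r < \rank (sample_mx x'))%N.
  by rewrite -rx (ltn_leqif (mxrank_leqif_sup sub)).
have : P (\rank (sample_mx x')).
  apply/asboolP; exists (N + 1)%N, x'; split => // j.
  by rewrite /x'; case: (fintype.split j).
by move=> /maxr; rewrite leqNgt lt.
Qed.

(** A left inverse of the evaluation matrix recovers the coefficients from
finitely many values. *)
Lemma coef_bound : exists2 K : R, 0 <= K & forall a (s : R),
  (forall x, Omega x -> `|lincomb u a x| <= s) -> forall i, `|a i| <= K * s.
Proof.
have [N [x [xO /row_fullP[C CA]]]] := unisolvent_points.
exists (\sum_i \sum_j `|C i j|); first by do 2 apply: sumr_ge0 => ? _.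
move=> a s fs i; pose v : 'cV[R]_n := \col_i a i.
have -> : a i = \sum_j C i j * lincomb u a (x j).
  have -> : a i = (C *m (sample_mx x *m v)) i 0 by rewrite mulmxA CA mul1mx mxE.
  rewrite mxE; apply: eq_bigr => j _; rewrite sample_mxE; congr (_ * _).
  by rewrite /lincomb; apply: eq_bigr => i' _; rewrite mxE.
have s0 j : 0 <= `|C i j| * s by rewrite mulr_ge0 // (le_trans _ (fs _ (xO j))).
apply: (@le_trans _ _ (\sum_j `|C i j| * s)).
  apply: (le_trans (ler_norm_sum _ _ _)); apply: ler_sum => j _.
  by rewrite normrM ler_wpM2l // fs.
rewrite (bigD1 i) //= mulrDl -mulr_suml lerDl mulr_suml sumr_ge0 // => i' _.
rewrite mulr_suml sumr_ge0 // => j _.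
by rewrite mulr_ge0 // (le_trans _ (fs _ (xO j))).
Qed.

End NormEquivalence.

Section Reduction.
Context (R : realType) (d : nat) (Omega : set 'rV[R]_d).
Context (mu : probability (borelRd R d) R).
Hypothesis cptO : compact Omega.
Hypothesis muO : mu Omega = 1%E.
Implicit Types (f g : 'rV[R]_d -> R).

Lemma rV_hausdorff : hausdorff_space 'rV[R]_d.
Proof.
exact: norm_hausdorff.
Qed.

Lemma measurable_open_rV (A : set 'rV[R]_d) :
  open A -> measurable (A : set (borelRd R d)).
Proof. by move=> oA; apply: sub_sigma_algebra. Qed.

Lemma measurable_Omega : measurable (Omega : set (borelRd R d)).
Proof.
rewrite -(setCK Omega); apply: measurableC; apply: measurable_open_rV.
by apply: closed_openC; apply: compact_closed => //; exact: rV_hausdorff.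
Qed.

Lemma within_preimage f (B : set R) : {within Omega, continuous f} -> open B ->
  exists2 G : set 'rV[R]_d, open G & G `&` Omega = (f @^-1` B) `&` Omega.
Proof.
move=> /continuousP cf /cf /open_subspaceP[G oG e]; by exists G.
Qed.

Lemma measurable_within f : {within Omega, continuous f} ->
  measurable_fun (Omega : set (borelRd R d)) (f : borelRd R d -> R).
Proof.
move=> cf; apply: (measurability _ (measurable_realfun.RGenOpens.measurableE R)).
move=> _ [_ [a [b ->] <-]].
have [G oG e] := within_preimage cf (@interval_open _ (BRight a) (BLeft b) isT isT).
rewrite setIC -e; apply: measurableI; last exact: measurable_Omega.
exact: measurable_open_rV.
Qed.

Definition epow_integral (p : R) f : \bar R :=
  (\int[mu]_(x in (Omega : set (borelRd R d))) (`|f x| `^ p)%:E)%E.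

Lemma LpN_epow_integral p f : p != 0 ->
  LpN Omega mu p f = (epow_integral p f `^ p^-1)%E.
Proof.
move=> p0; rewrite /LpN unlock /epow_integral [in RHS]integral_mkcond; congr (_ `^ _)%E.
apply: eq_integral => x _; rewrite /= /patch; case: ifP => // _.
by rewrite normr0 powR0.
Qed.

Lemma within_bounded f : {within Omega, continuous f} ->
  exists2 K, 0 <= K & forall x, Omega x -> `|f x| <= K.
Proof.
move=> cf.
have [K [_ HK]] := compact_bounded (continuous_compact cf cptO).
exists (Num.max 0 (K + 1)); first by rewrite le_max lexx.
move=> x Ox; rewrite le_max; apply/orP; right.
by apply: HK; [rewrite ltrDl | exists x].
Qed.

Lemma measurable_pow p f : {within Omega, continuous f} ->
  measurable_fun (Omega : set (borelRd R d)) 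
    (@EFin R \o (fun x : borelRd R d => `|f x| `^ p)).
Proof.
move=> cf; apply/measurable_EFinP.
apply: (measurableT_comp (measurable_powR p)).
exact: measurableT_comp (measurable_within cf).
Qed.

Lemma epow_integral_le p f s : 0 <= p -> {within Omega, continuous f} ->
  (forall x, Omega x -> `|f x| <= s) -> (epow_integral p f <= (s `^ p)%:E)%E.
Proof.
move=> p0 cf fs.
apply: (@le_trans _ _ (\int[mu]_(x in (Omega : set (borelRd R d))) (s `^ p)%:E)%E).
  apply: ge0_le_integral => //; first exact: measurable_Omega.
  - exact: (measurable_pow p cf).
  - by move=> x Ox; rewrite lee_fin ler_powR2r // fs.
by rewrite (integral_cst mu measurable_Omega) [X in (_ * X)%E]muO mule1.
Qed.

Lemma epow_integral_ge0 p f : (0 <= epow_integral p f)%E.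
Proof. by apply: integral_ge0 => x _; rewrite lee_fin powR_ge0. Qed.

Definition pow_integral (p : R) f : R := fine (epow_integral p f).

Lemma epow_integral_fin p f : 0 <= p -> {within Omega, continuous f} ->
  epow_integral p f = (pow_integral p f)%:E.
Proof.
move=> p0 cf; rewrite /pow_integral fineK // ge0_fin_numE ?epow_integral_ge0 //.
have [K K0 fK] := within_bounded cf.
exact: le_lt_trans (epow_integral_le p0 cf fK) (ltry _).
Qed.

Lemma pow_integral_ge0 p f : 0 <= pow_integral p f.
Proof. exact: fine_ge0 (epow_integral_ge0 _ _). Qed.

Lemma LpN_pow_integral p f : 0 < p -> {within Omega, continuous f} ->
  LpN Omega mu p f = (pow_integral p f `^ p^-1)%:E.
Proof.
move=> p0 cf; rewrite LpN_epow_integral ?gt_eqF //.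
by rewrite epow_integral_fin ?(ltW p0) // poweR_EFin.
Qed.

End Reduction.

(** * Finitely many cells of small oscillation *)

Section Cells.
Context (R : realType) (d : nat) (Omega : set 'rV[R]_d).
Context (mu : probability (borelRd R d) R).
Hypothesis cptO : compact Omega.
Hypothesis muO : mu Omega = 1%E.
Context (n : nat) (u : 'I_n -> 'rV[R]_d -> R).
Hypothesis cu : forall i, {within Omega, continuous (u i)}.

(** The neighbourhood is open in the whole space, which gives Borel cells. *)
Lemma oscillation_nbhd (e : R) x : 0 < e -> Omega x -> exists G : set 'rV[R]_d,
  [/\ open G, G x & forall z, G z -> Omega z -> forall i, `|u i z - u i x| <= e].
Proof.
move=> e0 Ox.
have near : nbhs x [set z | forall i, Omega z -> `|u i z - u i x| <= e].
  pose g i (z : 'rV[R]_d) := Omega z -> `|u i z - u i x| <= e.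
  have : nbhs x [set z | forall i, g i z]; last by apply.
  apply: (@filter_forall _ _ (fun i => [set z | g i z]) (nbhs x) (nbhs_filter x)) => i.
  have [G oG GE] := within_preimage (@cu i) (ball_open (u i x) e).
  have Gx : G x.
    by suff [] : (G `&` Omega) x by []; rewrite GE; split => //; exact: ballxx.
  apply: filterS (open_nbhs_nbhs (conj oG Gx)) => z Gz Oz.
  have : (G `&` Omega) z by []; rewrite GE => -[+ _].
  by rewrite /= /ball /= distrC => /ltW.
have := nbhs_interior near; rewrite nbhsE => -[G [oG Gx] GS].
exists G; split => // z Gz Oz i.
by have := interior_subset (GS z Gz); apply.
Qed.

(** The cells of the partition subordinate to a finite open cover: the points
whose first neighbourhood in the list has a given index. *)
Lemma measurable_first_hit (G : 'rV[R]_d -> set 'rV[R]_d) (s : seq 'rV[R]_d) k :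
  (forall y, y \in s -> open (G y)) ->
  measurable
    ([set x | Omega x /\ find (fun y => `[< G y x >]) s = k] : set (borelRd R d)).
Proof.
elim: s k => [|y s IH] k oG.
  case: k => [|k] /=.
    rewrite (_ : [set x | _] = Omega); first exact: measurable_Omega.
    by apply/seteqP; split => x //= [].
  by rewrite (_ : [set x | _] = set0) //; apply/seteqP; split => x //= [].
have oy : open (G y) by apply: oG; rewrite mem_head.
have mG := measurable_open_rV oy.
case: k => [|k].
  rewrite (_ : [set x | _] = Omega `&` G y).
    by apply: measurableI => //; exact: measurable_Omega.
  by apply/seteqP; split => x /= [Ox]; case: asboolP.
rewrite (_ : [set x | _] = (~` G y) `&`
    [set x | Omega x /\ find (fun y => `[< G y x >]) s = k]).
  apply: measurableI; first exact: measurableC.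
  by apply: IH => z zs; apply: oG; rewrite inE zs orbT.
apply/seteqP; split => x /=.
  by case=> Ox; case: asboolP => // nG [<-].
by case=> nG [Ox <-]; split => //; case: asboolP.
Qed.

(** A finite subcover by sets of small oscillation, made disjoint.  Only an
upper bound of the integral is asked for, so that any function that is
constant on the cells and dominates |f|^p can be used for [v]. *)
Lemma finite_cells (e p : R) : 0 < e -> 0 <= p ->
  exists N (y : 'I_N -> 'rV[R]_d) (w : 'I_N -> R),
  [/\ forall c, Omega (y c), forall c, 0 <= w c, \sum_c w c = 1 &
   forall f (v : 'I_N -> R), {within Omega, continuous f} -> (forall c, 0 <= v c) ->
    (forall c x, Omega x -> (forall i, `|u i x - u i (y c)| <= e) ->
       `|f x| `^ p <= v c) ->
    pow_integral Omega mu p f <= \sum_c w c * v c].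
Proof.
move=> e0 p0.
have /choice[G GP] : forall x, exists G : set 'rV[R]_d, Omega x ->
  [/\ open G, G x & forall z, G z -> Omega z -> forall i, `|u i z - u i x| <= e].
  move=> x; have [Ox|nOx] := pselect (Omega x); last by exists set0.
  by have [G H] := oscillation_nbhd e0 Ox; exists G.
move: cptO; rewrite compact_cover => /(_ _ Omega G).
case=> [x Ox|x Ox|D DO OD]; first by have [] := GP x Ox.
  by exists x => //; have [] := GP x Ox.
pose s := finmap.enum_fset D; pose N := size s.
have sO y : y \in s -> Omega y by move=> ys; have := DO y ys; rewrite inE.
pose idx x := find (fun y => `[< G y x >]) s.
have idxP x : Omega x -> (idx x < N)%N.
  move=> Ox; rewrite -has_find; apply/hasP.
  have [y /= yD Gyx] := OD x Ox; exists y => //; exact/asboolP.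
pose y (c : 'I_N) := nth 0 s c.
have Oy c : Omega (y c) by apply/sO/mem_nth.
pose E (c : 'I_N) : set (borelRd R d) := [set x | Omega x /\ idx x = c].
have mE c : measurable (E c).
  by apply: measurable_first_hit => z /sO Oz; have [] := GP z Oz.
pose w c := fine (mu (E c)).
have w0 c : 0 <= w c by apply: fine_ge0.
have muE c : mu (E c) = (w c)%:E by rewrite fineK // fin_num_measure.
have EO c : E c `<=` Omega by move=> x [].
have intE (v : 'I_N -> R) : (forall c, 0 <= v c) ->
  (\int[mu]_(x in (Omega : set (borelRd R d))) (\sum_c v c * \1_(E c) x)%:E
   = (\sum_c w c * v c)%:E)%E.
  move=> v0; under eq_integral do rewrite -sumEFin.
  rewrite ge0_integral_sum //=; last 3 first.
  - exact: measurable_Omega.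
  - move=> c; apply/measurable_EFinP; apply: measurable_funM => //.
  - by move=> c x _; rewrite lee_fin mulr_ge0.
  rewrite -sumEFin; apply: eq_bigr => c _.
  under eq_integral do rewrite EFinM.
  rewrite ge0_integralZl_EFin //; last first.
  - exact/measurable_EFinP.
  - exact: measurable_Omega.
  rewrite integral_indic //; last exact: measurable_Omega.
  by rewrite (setIidl (@EO c)) [X in (_ * X)%E]muE -EFinM mulrC.
(* The cells partition [Omega], so exactly one indicator is nonzero. *)
have pick (v : 'I_N -> R) x (Ox : Omega x) :
    \sum_c v c * \1_(E c) x = v (Ordinal (idxP x Ox)).
  rewrite (bigD1 (Ordinal (idxP x Ox))) //= indicE mem_set // mulr1.
  rewrite big1 ?addr0 // => c ne.
  rewrite indicE memNset ?mulr0 // => -[_ ec]; case/eqP: ne; exact/val_inj.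
exists N, y, w; split => //.
  apply: EFin_inj; have := intE (fun=> 1) (fun=> ler01).
  under [in X in _ = X]eq_bigr do rewrite mulr1.
  move=> <-; rewrite -[RHS]muO -[mu Omega]mul1e.
  rewrite -(integral_cst mu (measurable_Omega cptO)).
  by apply: eq_integral => x; rewrite inE => Ox; rewrite (pick (fun=> 1)).
move=> f v cf v0 fv.
rewrite -lee_fin -epow_integral_fin // -intE //.
apply: ge0_le_integral => //.
- exact: measurable_Omega.
- exact: (measurable_pow cptO p cf).
- apply/measurable_EFinP; apply: measurable_sum => c; apply: measurable_funM => //.
move=> x Ox; rewrite (pick _ _ Ox) lee_fin.
apply: fv => // i.
set c := Ordinal _.
have Gc : G (y c) x.
  have : has (fun y => `[< G y x >]) s by rewrite has_find; exact: (idxP x Ox).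
  by move=> /(nth_find 0) /asboolP.
by have [_ _ H] := GP (y c) (Oy c); apply: H.
Qed.

End Cells.

(** * Discretization for a subspace of continuous functions *)

Section SubspaceDiscretization.
Context (R : realType) (d : nat) (Omega : set 'rV[R]_d).
Context (mu : probability (borelRd R d) R).
Hypothesis cptO : compact Omega.
Hypothesis muO : mu Omega = 1%E.
Context (n : nat) (u : 'I_n -> 'rV[R]_d -> R).
Hypothesis cu : forall a, {within Omega, continuous (lincomb u a)}.
Hypothesis indep : forall a, (forall x, Omega x -> lincomb u a x = 0) ->
  forall i, a i = 0.
Context (p M : R).
Hypothesis p2 : 2 <= p.
Hypothesis M1 : 1 <= M.
Hypothesis nikolskii : forall a x, Omega x ->
  `|lincomb u a x| `^ p <= M * pow_integral Omega mu p (lincomb u a).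

Let p0 : 0 < p. Proof. by apply: lt_le_trans p2. Qed.
Let M0 : 0 < M. Proof. by apply: lt_le_trans M1. Qed.

Lemma lincomb_delta i : lincomb u (fun j => (j == i)%:R) = u i.
Proof.
apply/funext => x; rewrite /lincomb (bigD1 i) //= eqxx mul1r big1 ?addr0 // => j.
by move=> /negbTE ->; rewrite mul0r.
Qed.

(** The cells are so fine that [f] differs from its value at the node of the
cell by at most a quarter of its p-norm, uniformly in the coefficients; the
resulting error, half of the integral, is absorbed. *)
Lemma quadrature : exists N (y : 'I_N -> 'rV[R]_d) (w : 'I_N -> R),
  [/\ forall c, Omega (y c), forall c, 0 <= w c, \sum_c w c = 1 &
   forall a, pow_integral Omega mu p (lincomb u a) <=
     2 * 2 `^ p * \sum_c w c * `|lincomb u a (y c)| `^ p].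
Proof.
have cui i : {within Omega, continuous (u i)} by rewrite -lincomb_delta.
have [K K0 HK] := coef_bound indep.
pose m0 := M `^ p^-1.
have nKm : 0 <= n%:R * K * m0 by rewrite !mulr_ge0 // powR_ge0.
(* Then n K m0 e <= 1/4; the summand 1 only keeps e finite. *)
pose e := (4 * (n%:R * K * m0 + 1))^-1.
have e0 : 0 < e by rewrite invr_gt0 mulr_gt0 // ltr_wpDl.
have [N [y [w [Oy w0 w1 cells]]]] := finite_cells cptO muO cui e0 (ltW p0).
exists N, y, w; split => // a; set f := lincomb u a; set I := pow_integral _ _ _ _.
have I0 : 0 <= I by exact: pow_integral_ge0.
pose r := I `^ p^-1.
have r0 : 0 <= r by exact: powR_ge0.
have rp : r `^ p = I by rewrite -powRrM mulVf ?gt_eqF // powRr1.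
have m0p : m0 `^ p = M by rewrite -powRrM mulVf ?gt_eqF // powRr1 // ltW.
have fb x : Omega x -> `|f x| <= m0 * r.
  move=> Ox; apply: (@powR_le2r _ p) => //; first by rewrite mulr_ge0 // powR_ge0.
  by rewrite powRM ?powR_ge0 // rp m0p; exact: nikolskii.
have aK i := HK a _ fb i.
pose v c := 2 `^ p * (`|f (y c)| `^ p + (r / 4) `^ p).
have := cells f v (@cu a); have v0 c : 0 <= v c.
  by rewrite mulr_ge0 ?powR_ge0 // addr_ge0 ?powR_ge0.
move=> /(_ v0) H.
have {}H : I <= \sum_c w c * v c.
  apply: H => c x Ox close.
  have close' : `|f x - f (y c)| <= r / 4.
    rewrite /f /lincomb -sumrB; apply: (le_trans (ler_norm_sum _ _ _)).
    apply: (@le_trans _ _ (\sum_(i < n) K * (m0 * r) * e)).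
      apply: ler_sum => i _; rewrite -mulrBr normrM.
      by apply: ler_pM.
    rewrite sumr_const card_ord -[leLHS]mulr_natl.
    have -> : n%:R * (K * (m0 * r) * e) = r * (n%:R * K * m0 * e) by ring.
    rewrite ler_wpM2l // /e invfM mulrCA -[leRHS]mulr1 ler_wpM2l //.
    by rewrite ler_pdivrMr ?mul1r ?lerDl // ltr_wpDl.
  have : `|f x| <= `|f (y c)| + r / 4.
    by rewrite addrC -lerBlDr; exact: le_trans (lerB_dist _ _) close'.
  move=> /(ler_powR2r (ltW p0) (normr_ge0 _)) /le_trans; apply.
  by apply: powR_add_le; rewrite ?(ltW p0) // divr_ge0.
have eqv : \sum_c w c * v c =
    2 `^ p * (\sum_c w c * `|f (y c)| `^ p) + 2 `^ p * (r / 4) `^ p.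
  rewrite mulr_sumr -[X in _ + X]mul1r -[X in _ + X * _]w1 mulr_suml -big_split /=.
  by apply: eq_bigr => c _; rewrite /v; ring.
have half : 2 `^ p * (r / 4) `^ p <= I / 2.
  rewrite -powRM ?divr_ge0 //.
  have -> : 2 * (r / 4) = r * 2^-1 by field.
  rewrite powRM // rp ler_wpM2l //.
  have h : 0 < (2^-1 : R) <= 1 by rewrite invr_gt0 invf_le1 ?ltr0n ?ler1n.
  by apply: ge1r_powR => //; apply: le_trans p2; rewrite ler1n.
by move: H; rewrite eqv -mulrA => /le_absorb; apply.
Qed.

(** The values at the nodes form a subspace of functions on a finite space,
where the pointwise bound persists with the constant lost in [quadrature]. *)
Theorem subspace_discretization m J : (0 < J)%N ->
  2 * 2 `^ p * M <= level R J `^ p ->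
  128 * J%:R * 2 `^ p * (2 * 2 `^ p * M) *
    (ln (2 * J%:R) + 2 * 16 `^ p * ln (4 * m).+1%:R) < m%:R ->
  exists2 xi : 'I_m -> 'rV[R]_d, (forall i, Omega (xi i)) &
    forall a, pow_integral Omega mu p (lincomb u a) <=
      128 * (2 `^ p * 2 `^ p * 2 `^ p) / m%:R * \sum_(i < m) `|lincomb u a (xi i)| `^ p.
Proof.
move=> J0 MJ enough.
have [N [y [w [Oy w0 w1 quad]]]] := quadrature.
pose V := [set g : 'I_N -> R | exists a, g = fun c => lincomb u a (y c)].
have V0 : V (fun=> 0).
  exists (fun=> 0); apply/funext => c; rewrite /lincomb big1 // => i _.
  by rewrite mul0r.
have VC a b f g : V f -> V g -> V (fun c => a * f c + b * g c).
  move=> [a1 ->] [a2 ->]; exists (fun i => a * a1 i + b * a2 i).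
  apply/funext => c; rewrite /lincomb !mulr_sumr -big_split /=.
  by apply: eq_bigr => i _; ring.
have P1 : 1 <= 2 * 2 `^ p :> R.
  by have := pow2_ge2 p2; lra.
have M'1 : 1 <= 2 * 2 `^ p * M by rewrite mulr_ege1.
have nik f c : V f -> `|f c| `^ p <= 2 * 2 `^ p * M * pmass w p f.
  move=> [a ->]; apply: (le_trans (nikolskii a (Oy c))).
  by rewrite (mulrC _ M) -mulrA ler_wpM2l ?(ltW M0).
have [xi H] := finite_discretization p2 w0 w1 V0 VC M'1 nik J0 MJ enough.
exists (y \o xi) => [i|a]; first exact: Oy.
apply: (le_trans (quad a)).
have := H (fun c => lincomb u a (y c)) (ex_intro _ a erefl).
move=> /(ler_wpM2l (_ : 0 <= 2 * 2 `^ p)) => /(_ (mulr_ge0 _ (powR_ge0 _ _))).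
move=> /(_ (ler0n _ _)) /le_trans; apply.
by rewrite le_eqVlt; apply/orP; left; apply/eqP; rewrite /=; ring.
Qed.

End SubspaceDiscretization.

(** * The number of points *)

Section SampleSize.
Context (R : realType).

Lemma ln_le_id (x : R) : 0 < x -> ln x <= x.
Proof.
move=> x0; have := @le_ln1Dx R (x - 1); rewrite ltrBrDl addrN => /(_ x0).
by rewrite addrC subrK; lra.
Qed.

Lemma pow2_ge_exp (x : R) J : 2 * x + 6 <= J%:R -> 4 * expR x <= 2 ^+ J.
Proof.
move=> xJ; apply: (@le_trans _ _ (expR (J%:R * 2^-1))); last first.
  by rewrite expRM_natl lerXn2r ?nnegrE ?expR_ge0 ?expR_half_le2.
apply: (@le_trans _ _ (expR (3 + x))).
  by rewrite expRD ler_wpM2r ?expR_ge0 //; have := expR_ge1Dx (3 : R); lra.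
by rewrite ler_expR; lra.
Qed.

Context (p : R).
Hypothesis p2 : 2 <= p.
Let p0 : 0 < p. Proof. by apply: lt_le_trans p2. Qed.

(** The factor E for which m > E s * (b L) is needed, where b = B^p n, L is the
logarithm and s^2 = m / (b L); see [sample_size]. *)
Definition overhead : R := 4096 * (2 `^ p * 2 `^ p) * (32 + 2 * 16 `^ p * (p + 13)).

Lemma overhead_ge1 : 1 <= overhead.
Proof.
have h2 := pow2_ge2 p2.
have h16 : 0 <= 2 * 16 `^ p * (p + 13).
  by rewrite !mulr_ge0 ?powR_ge0 //; have := p2; lra.
rewrite /overhead; apply: mulr_ege1; last lra.
by apply: mulr_ege1; [lra | apply: mulr_ege1; lra].
Qed.

(** With s, b and L as in [overhead], all logarithms that occur, including
that of m itself, are O(s + L), and L <= s, so that the requirement reads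
E s < s^2.  The hypothesis is s >= (2 E + 2) L, and L >= 1/2. *)
Lemma sample_size (B : R) (n m : nat) : 1 <= B -> (0 < n)%N ->
  (2 * overhead + 2) ^+ 2 * B `^ p * n%:R * ln (2 * B * n%:R) ^+ 3 <= m%:R ->
  (n <= m)%N /\ exists J, [/\ (0 < J)%N,
    2 * 2 `^ p * (B `^ p * n%:R) <= level R J `^ p &
    128 * J%:R * 2 `^ p * (2 * 2 `^ p * (B `^ p * n%:R)) *
      (ln (2 * J%:R) + 2 * 16 `^ p * ln (4 * m).+1%:R) < m%:R].
Proof.
move=> B1 n0; set E := overhead; set b := B `^ p * n%:R; set L := ln _.
have E1 : 1 <= E := overhead_ge1.
have nR : 1 <= n%:R :> R by rewrite ler1n.
have Bn : 1 <= B * n%:R by rewrite mulr_ege1.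
set x := 2 * B * n%:R in L *.
have x2 : 2 <= x by rewrite /x -mulrA; lra.
have x0 : 0 < x by lra.
have xL : expR L = x by rewrite lnK.
have L2 : 2^-1 <= L.
  by rewrite -ler_expR xL; apply: le_trans (expR_half_le2 R) x2.
have Bp : 1 <= B `^ p by rewrite -(powRr0 B); apply: ler_powR => //; exact: ltW.
have nb : n%:R <= b by rewrite /b -[leLHS]mul1r ler_wpM2r.
have b1 : 1 <= b by apply: le_trans nb.
have bx : 2 `^ p * b <= x `^ p.
  rewrite /x -mulrA [leRHS]powRM ?(le_trans _ Bn) // ler_wpM2l ?powR_ge0 //.
  rewrite powRM // ?(le_trans _ B1) // /b ler_wpM2l ?powR_ge0 //.
  by apply: le1r_powR => //; apply: le_trans p2; rewrite ler1n.
have P2 := pow2_ge2 p2.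
set g := 2 * E + 2; have -> : g ^+ 2 * B `^ p * n%:R * L ^+ 3 = (g * L) ^+ 2 * (b * L).
  by rewrite /b; ring.
move=> mb.
have bL : 0 < b * L by rewrite mulr_gt0 //; lra.
(* Work with s so that ln m <= 2 s + O(L) is a bound linear in s. *)
pose s : R := Num.sqrt (m%:R / (b * L)).
have s0 : 0 <= s by rewrite sqrtr_ge0.
have mE : m%:R = s ^+ 2 * (b * L).
  by rewrite sqr_sqrtr ?divr_ge0 ?(ltW bL) // divfK // gt_eqF.
have gL0 : 0 <= g * L by rewrite mulr_ge0 // /g; lra.
have gs : g * L <= s.
  by rewrite -(@ler_pXn2r _ 2) ?nnegrE // -(ler_pM2r bL) -mE.
have Es : E < s by apply: lt_le_trans gs; rewrite /g; nra.
have Ls : L <= s by apply: le_trans gs; rewrite /g; nra.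
have s1 : 1 <= s by apply: le_trans (ltW Es).
have mn : n%:R <= m%:R :> R.
  rewrite mE; apply: (le_trans nb).
  have h : 1 <= s ^+ 2 * L.
    have s2 : 2 <= s by apply: le_trans gs; rewrite /g; nra.
    have s4 : 4 <= s ^+ 2 by rewrite expr2; nra.
    by apply: (@le_trans _ _ (4 * 2^-1)); [lra | apply: ler_pM].
  by rewrite mulrCA -[leLHS]mulr1 ler_wpM2l // (le_trans _ b1).
split; first by rewrite -(ler_nat R).
have m0 : (0 < m)%N by rewrite -(ltr0n R); apply: lt_le_trans mn; rewrite ltr0n.
(* 2^J / 2 >= 2 x with x = 2 B n = exp L, using 2 >= exp (1/2). *)
pose J := (Num.truncn (2 * L + 6)).+1.
have y0 : 0 <= 2 * L + 6 by lra.
have Jlb : 2 * L + 6 <= J%:R by rewrite ltW // /J truncnS_gt.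
have Jub : J%:R <= 16 * L.
  have : (Num.truncn (2 * L + 6))%:R <= 2 * L + 6 by rewrite truncn_le.
  by rewrite /J -natr1; lra.
exists J; split => //.
  have lJ : 2 * x <= level R J.
    rewrite /level ler_pdivlMr // (_ : 2 * x * 2 = 4 * expR L).
      exact: pow2_ge_exp Jlb.
    by rewrite xL; ring.
  apply: (@le_trans _ _ ((2 * x) `^ p)); last first.
    by apply: ler_powR2r => //; [exact: ltW | rewrite mulr_ge0 // ltW].
  by rewrite powRM ?(ltW x0) // -mulrA ler_pM // ?mulr_ge0 ?powR_ge0 // (le_trans _ b1).
pose P : R := 2 `^ p; pose Q : R := 16 `^ p.
have Q0 : 0 <= Q by exact: powR_ge0.
have L0 : 0 < L by apply: lt_le_trans L2; rewrite invr_gt0.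
have b0 : 0 < b by apply: lt_le_trans b1.
have PP : 0 <= P by exact: powR_ge0.
have lnJ : ln (2 * J%:R) <= 32 * L.
  have : 0 < 2 * J%:R :> R by rewrite mulr_gt0 // ltr0n.
  by move=> /ln_le_id; lra.
have lnb : ln b <= p * L.
  rewrite -ln_powR ler_ln ?posrE ?powR_gt0 ?(lt_le_trans _ b1) //.
  apply: le_trans bx; rewrite -[leLHS]mul1r ler_wpM2r ?(le_trans _ b1) //.
  by apply: le_trans P2; rewrite ler1n.
have lnm : ln (4 * m).+1%:R <= 2 * s + (p + 11) * L.
  have s0' : 0 < s by apply: lt_le_trans s1.
  have m1 : (4 * m).+1%:R <= 5 * (s ^+ 2 * (b * L)) :> R.
    rewrite -mE -natr1 natrM; have : 1 <= m%:R :> R by rewrite ler1n.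
    lra.
  apply: (@le_trans _ _ (ln (5 * (s ^+ 2 * (b * L))))).
    by rewrite ler_ln // ?posrE ?ltr0n // mulr_gt0 // mulr_gt0 // exprn_gt0.
  have s20 : 0 < s ^+ 2 by rewrite exprn_gt0.
  rewrite lnM ?posrE // ?(mulr_gt0 s20) // lnM ?posrE // lnM ?posrE //.
  rewrite lnXn // mulr2n.
  have h5 : 0 < 5 :> R by [].
  have := ln_le_id h5; have := ln_le_id s0'; have := ln_le_id L0.
  move: lnb L2; rewrite !mulrDl => *; lra.
have Q2 : 0 <= 2 * Q by rewrite mulr_ge0.
have t1 : ln (2 * J%:R) + 2 * Q * ln (4 * m).+1%:R <= s * (32 + 2 * Q * (p + 13)).
  have h : ln (4 * m).+1%:R <= s * (p + 13).
    apply: (le_trans lnm).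
    have : (p + 11) * L <= (p + 11) * s by rewrite ler_wpM2l //; have := p2; lra.
    move=> hh; apply: (le_trans (lerD (lexx _) hh)).
    by rewrite le_eqVlt; apply/orP; left; apply/eqP; ring.
  rewrite mulrDr lerD //.
    by apply: (le_trans lnJ); rewrite mulrC ler_wpM2r.
  by rewrite mulrCA ler_wpM2l.
have JE : 128 * J%:R * P * (2 * P * b) <= 4096 * (P * P) * (b * L).
  have -> : 128 * J%:R * P * (2 * P * b) = 256 * (P * P) * b * J%:R by ring.
  have -> : 4096 * (P * P) * (b * L) = 256 * (P * P) * b * (16 * L) by ring.
  apply: ler_wpM2l Jub.
  exact: mulr_ge0 (mulr_ge0 (ler0n _ 256) (mulr_ge0 PP PP)) (ltW b0).
have t0 : 0 <= ln (2 * J%:R) + 2 * Q * ln (4 * m).+1%:R.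
  rewrite addr_ge0 ?mulr_ge0 // ln_ge0 // ?ler1n // -natrM ler1n muln_gt0.
  by [].
apply: (le_lt_trans (ler_pM _ t0 JE t1)).
  exact: mulr_ge0 (mulr_ge0 (mulr_ge0 (ler0n _ 128) (ler0n _ J)) PP)
    (mulr_ge0 (mulr_ge0 (ler0n _ 2) PP) (ltW b0)).
have -> : 4096 * (P * P) * (b * L) * (s * (32 + 2 * Q * (p + 13)))
   = E * s * (b * L) by rewrite /E /overhead -/P -/Q; ring.
by rewrite mE ltr_pM2r // expr2 ltr_pM2r // (lt_le_trans _ s1).
Qed.

End SampleSize.

(** * Integrals of continuous functions and the L_p setting *)

Section Recovery.
Context (R : realType) (d : nat) (Omega : set 'rV[R]_d).
Context (mu : probability (borelRd R d) R).
Hypothesis cptO : compact Omega.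
Hypothesis muO : mu Omega = 1%E.
Context (p : R).
Hypothesis p2 : 2 <= p.
Implicit Types (f g : 'rV[R]_d -> R).

Let p0 : 0 < p. Proof. by apply: lt_le_trans p2. Qed.

Lemma within_continuousB f g : {within Omega, continuous f} ->
  {within Omega, continuous g} -> {within Omega, continuous (f \- g)}.
Proof. by move=> cf cg x; apply: cvgB; [exact: cf | exact: cg]. Qed.

Lemma continuous_in_Lp f : {within Omega, continuous f} -> in_Lp Omega mu p f.
Proof.
move=> cf; rewrite /in_Lp /Lfun inE /=; apply/andP; split.
  rewrite inE /=; apply/(measurable_restrictT _ (measurable_Omega cptO)).
  exact: (measurable_within cptO cf).
rewrite inE /= /finite_norm.
by have := LpN_pow_integral cptO muO p0 cf; rewrite /LpN => ->; exact: ltry.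
Qed.

Lemma pow_integral_ae0 f : {within Omega, continuous f} ->
  {ae mu, forall x : borelRd R d, Omega x -> f x = 0} -> pow_integral Omega mu p f = 0.
Proof.
move=> cf f0; rewrite /pow_integral /epow_integral.
rewrite (ge0_ae_eq_integral (g := fun=> 0%E)) ?integral0 //.
- exact: measurable_Omega.
- exact: (measurable_pow cptO p cf).
apply: filterS f0 => x fx Ox; rewrite fx // normr0 powR0 //.
by rewrite gt_eqF.
Qed.

Lemma pow_integral_add_le f g (s : R) : {within Omega, continuous f} ->
  {within Omega, continuous g} ->
  (forall x, Omega x -> `|f x| <= s + `|g x|) -> 0 <= s ->
  pow_integral Omega mu p f <= 2 `^ p * (s `^ p + pow_integral Omega mu p g).
Proof.
move=> cf cg fg s0.
have mO := measurable_Omega cptO.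
have cst : (\int[mu]_(x in (Omega : set (borelRd R d))) (2 `^ p * s `^ p)%:E
    = (2 `^ p * s `^ p)%:E)%E.
  by rewrite (integral_cst mu mO) [X in (_ * X)%E]muO mule1.
rewrite mulrDr -lee_fin EFinD -cst [X in (_ + X)%E]EFinM.
rewrite -!epow_integral_fin ?(ltW p0) // /epow_integral.
have mg := measurable_pow cptO p cg.
rewrite -ge0_integralZl_EFin ?powR_ge0 //.
rewrite -ge0_integralD //; last exact: measurable_funeM; last first.
  by move=> x _; rewrite lee_fin mulr_ge0 ?powR_ge0.
apply: ge0_le_integral => //.
- exact: (measurable_pow cptO p cf).
- apply: emeasurable_funD => //; exact: measurable_funeM.
move=> x Ox; rewrite -EFinM -EFinD lee_fin -mulrDr.
apply: le_trans (powR_add_le (ltW p0) s0 (normr_ge0 _)).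
by apply: ler_powR2r; rewrite ?(ltW p0) // fg.
Qed.

End Recovery.

(** * Recovery *)

Section RecoveryBound.
Context (R : realType) (d : nat) (Omega : set 'rV[R]_d).
Context (mu : probability (borelRd R d) R).
Hypothesis cptO : compact Omega.
Hypothesis muO : mu Omega = 1%E.
Context (p : R).
Hypothesis p2 : 2 <= p.

Let p0 : 0 < p. Proof. by apply: lt_le_trans p2. Qed.

Lemma lincombB n (u : 'I_n -> 'rV[R]_d -> R) a b :
  lincomb u a \- lincomb u b = lincomb u (fun i => a i - b i).
Proof.
apply/funext => x; rewrite /lincomb /= -sumrB.
by apply: eq_bigr => i _; rewrite mulrBl.
Qed.

(** The minimizer does at least as well as [g] on the sample, so [g - v] is
small on the sample; the discretization hypothesis, available only on the
subspace, applies to [g - v] but not to [f - v]. *)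
Lemma recovery_bound n (u : 'I_n -> 'rV[R]_d -> R) m (xi : 'I_m -> 'rV[R]_d)
    (D s : R) (f g v : 'rV[R]_d -> R) :
  (forall a, {within Omega, continuous (lincomb u a)}) ->
  {within Omega, continuous f} -> (0 < m)%N -> (forall i, Omega (xi i)) ->
  0 <= D ->
  (forall a, pow_integral Omega mu p (lincomb u a) <=
     D / m%:R * \sum_(i < m) `|lincomb u a (xi i)| `^ p) ->
  lpw_argmin p xi (range (lincomb u)) f v ->
  range (lincomb u) g -> 0 <= s -> (forall x, Omega x -> `|f x - g x| <= s) ->
  pow_integral Omega mu p (f \- v) <= 2 `^ p * (1 + D * (2 `^ p * 2)) * s `^ p.
Proof.
move=> cu cf m0 xiO D0 disc [[b _ bv] vmin] [a _ ag] s0 fg.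
have mR : 0 < m%:R :> R by rewrite ltr0n.
have p2n : 0 <= 2 `^ p :> R by exact: powR_ge0.
pose S (h : 'rV[R]_d -> R) := \sum_(i < m) `|f (xi i) - h (xi i)| `^ p.
have S0 h : 0 <= S h by apply: sumr_ge0 => i _; exact: powR_ge0.
have Sg : S g <= m%:R * s `^ p.
  rewrite -[m in m%:R]card_ord mulr_natl -sumr_const; apply: ler_sum => i _.
  by apply: ler_powR2r; rewrite ?(ltW p0) // fg.
have Sv : S v <= S g.
  have := vmin g (ex_intro2 _ _ a I ag); rewrite /discrete_err.
  move=> /(powR_le2r _) H; rewrite -(@ler_pM2l _ m%:R^-1) ?invr_gt0 //.
  by apply: H; rewrite ?invr_gt0 // mulr_ge0 ?invr_ge0 // ?S0.
have gv : g \- v = lincomb u (fun i => a i - b i) by rewrite -ag -bv lincombB.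
have Sgv : \sum_(i < m) `|lincomb u (fun i => a i - b i) (xi i)| `^ p <=
    2 `^ p * 2 * (m%:R * s `^ p).
  apply: (@le_trans _ _ (2 `^ p * (S g + S v))); last first.
    by rewrite -mulrA ler_wpM2l //; lra.
  rewrite mulrDr !mulr_sumr -big_split /=; apply: ler_sum => i _.
  rewrite -mulrDr -gv /=.
  apply: le_trans (powR_add_le (ltW p0) (normr_ge0 _) (normr_ge0 _)).
  apply: ler_powR2r; rewrite ?(ltW p0) //.
  by rewrite (distrC (f (xi i)) (g (xi i))) ler_distD.
have rgv : pow_integral Omega mu p (g \- v) <= D * (2 `^ p * 2) * s `^ p.
  rewrite gv; apply: (le_trans (disc _)).
  apply: (le_trans (ler_wpM2l _ Sgv)); first by rewrite divr_ge0 // ltW.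
  by rewrite le_eqVlt; apply/orP; left; apply/eqP; field; rewrite gt_eqF.
have cg : {within Omega, continuous (g \- v)} by rewrite gv.
have cv : {within Omega, continuous v} by rewrite -bv.
apply: (le_trans (pow_integral_add_le cptO muO p2 (within_continuousB cf cv) cg _ s0)).
  move=> x Ox /=; apply: (le_trans (ler_distD (g x) _ _)).
  by rewrite lerD2r fg.
by rewrite -mulrA ler_wpM2l // mulrDl mul1r lerD2l.
Qed.

Lemma supN_bound (f : 'rV[R]_d -> R) x : Omega x -> (`|f x|%:E <= supN Omega f)%E.
Proof. by move=> Ox; apply: ereal_sup_ubound; exists x. Qed.

Lemma condNpB_pow_integral B n (X : set ('rV[R]_d -> R)) f x : 1 <= B ->
  {within Omega, continuous f} -> condNpB Omega mu p B n X -> X f -> Omega x ->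
  `|f x| `^ p <= B `^ p * n%:R * pow_integral Omega mu p f.
Proof.
move=> B1 cf nik Xf Ox.
have B0 : 0 <= B by apply: le_trans B1.
have := nik f Xf x Ox; rewrite (LpN_pow_integral cptO muO p0 cf) -EFinM lee_fin.
move=> /(ler_powR2r (ltW p0) (normr_ge0 _)) /le_trans; apply.
rewrite powRM ?mulr_ge0 ?powR_ge0 // powRM ?powR_ge0 // -!powRrM.
by rewrite mulVf ?gt_eqF // !powRr1 ?pow_integral_ge0.
Qed.

(** For functions of [X], vanishing almost everywhere forces vanishing on
[Omega], by the pointwise bound; so the dimension does not drop in L_p. *)
Lemma subspace_C_Lp B n X : 1 <= B -> subspace_C Omega n X ->
  condNpB Omega mu p B n X -> subspace_Lp Omega mu p n X.
Proof.
move=> B1 [[u [XE indep]] cX] nik; split; last first.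
  by move=> f /cX; exact: continuous_in_Lp.
exists u; split => // a ae0; apply: indep => x Ox.
have Xa : X (lincomb u a) by rewrite XE; exists a.
have := condNpB_pow_integral B1 (cX _ Xa) nik Xa Ox.
rewrite (pow_integral_ae0 cptO p2 (cX _ Xa) ae0) mulr0 => h.
apply/eqP; rewrite -normr_le0; apply: (@powR_le2r _ p) => //.
by rewrite powR0 // gt_eqF.
Qed.

End RecoveryBound.

Unset Implicit Arguments.

Theorem theorem4p7 (R : realType) (p : R) (hp : 2 < p) :
  exists c C : R, 0 < c /\ 0 < C /\
  forall (B : R) (d : nat) (Omega : set 'rV[R]_d)
    (mu : probability (borelRd R d) R) (F : set ('rV[R]_d -> R))
    (m n : nat)
    (A : ('I_m -> 'rV[R]_d) -> set ('rV[R]_d -> R) ->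
         ('rV[R]_d -> R) -> ('rV[R]_d -> R)),
    1 <= B ->
    compact Omega -> mu Omega = 1%E ->
    compact_in_C Omega F ->
    (0 < m)%N -> (0 < n)%N ->
    lpw_algorithm Omega mu p F A ->
    c * B `^ p * n%:R * (ln (2 * B * n%:R)) ^+ 3 <= m%:R ->
    (varrho_lp Omega mu p A F <= C%:E * kolmogorov_NpB Omega mu p B n F)%E.
Proof.
have p2 := ltW hp.
have p0 : 0 < p by apply: lt_le_trans p2.
pose P : R := 2 `^ p.
have P0 : 0 < P by rewrite powR_gt0.
pose D : R := 128 * (P * P * P).
have D0 : 0 <= D by rewrite mulr_ge0 // !mulr_ge0 // ltW.
pose Cp : R := P * (1 + D * (P * 2)).
have Cp0 : 0 < Cp by rewrite mulr_gt0 // ltr_wpDr // !mulr_ge0 // ltW.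
exists ((2 * overhead p + 2) ^+ 2), (Cp `^ p^-1).
have c0 : 0 < Cp `^ p^-1 by rewrite powR_gt0.
split; first by rewrite exprn_gt0 //; have := overhead_ge1 p2; lra.
split => //.
move=> B d Omega mu F m n A B1 cptO muO [cF _] m0 n0 hA hm.
have [nm [J [J0 MJ enough]]] := sample_size p2 B1 n0 hm.
rewrite -lee_pdivrMl //; apply: le_ereal_inf_tmp => _ [X [XC nik] <-].
rewrite lee_pdivrMl //.
have XLp := subspace_C_Lp cptO muO p2 B1 XC nik.
case: XC => -[u [XE indep]] cX.
have cu a : {within Omega, continuous (lincomb u a)}.
  by apply: cX; rewrite XE; exists a.
have M1 : 1 <= B `^ p * n%:R.
  apply: mulr_ege1; last by rewrite ler1n.
  by rewrite -(powRr0 B); apply: ler_powR => //; exact: ltW.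
have nik' a x : Omega x ->
    `|lincomb u a x| `^ p <= B `^ p * n%:R * pow_integral Omega mu p (lincomb u a).
  move=> Ox; apply: (condNpB_pow_integral cptO muO p2 B1 (cu a) nik _ Ox).
  by rewrite XE; exists a.
have [xi xiO disc] :=
  subspace_discretization cptO muO cu indep p2 M1 nik' J0 MJ enough.
have adm : admissible Omega mu p xi X by split => //; exists n; rewrite n0 nm.
apply: (@le_trans _ _ (ereal_sup [set LpN Omega mu p (f \- A xi X f) | f in F])).
  by apply: ereal_inf_lbound; exists (xi, X).
apply: ge_ereal_sup => _ [f Ff <-].
apply: (@le_trans _ _
  ((Cp `^ p^-1)%:E * ereal_inf [set supN Omega (f \- g)%R | g in X])%E); last first.
  apply: lee_wpmul2l; first by rewrite lee_fin ltW.
  by apply: ereal_sup_ubound; exists f.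
rewrite -lee_pdivrMl //; apply: le_ereal_inf_tmp => _ [g Xg <-].
rewrite lee_pdivrMl //.
have [x0 Ox0] : Omega !=set0.
  apply/set0P/eqP => O0; move: muO; rewrite O0 measure0 => /eqP.
  by rewrite eq_sym onee_eq0.
have sup0 := supN_bound (f \- g) Ox0.
have sub := @supN_bound R d Omega (f \- g).
case: (supN Omega (f \- g)) sup0 sub => [s|_ _|//]; last first.
  by rewrite gt0_muley ?lte_fin // leey.
rewrite lee_fin => s0 sub.
have {}s0 : 0 <= s by apply: le_trans s0.
have av : lpw_argmin p xi (range (lincomb u)) f (A xi X f) by rewrite -XE; apply: hA.
have Xg' : range (lincomb u) g by rewrite -XE.
have fg x : Omega x -> `|f x - g x| <= s.
  by move=> Ox; have := sub x Ox; rewrite lee_fin.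
have := recovery_bound cptO muO p2 cu (cF f Ff) m0 xiO D0 disc av Xg' s0 fg.
have cfv : {within Omega, continuous (f \- A xi X f)}.
  by apply: within_continuousB; [exact: cF | apply: cX; have [] := hA xi X f adm Ff].
rewrite (LpN_pow_integral cptO muO p0 cfv) -EFinM lee_fin => H.
have pi0 : 0 <= p^-1 by rewrite invr_ge0 ltW.
apply: (le_trans (ler_powR2r pi0 (pow_integral_ge0 _ _ _ _) H)).
by rewrite powRM ?powR_ge0 ?(ltW Cp0) // -powRrM mulfV ?gt_eqF // powRr1.
Qed.
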